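(* If there is an incremental-polynomial time algorithm solving ACS+A-Enum on acyclic implicational bases, then there is a polynomial-time algorithm solving CGE+A-Dec on acyclic convex geometries.
   Context: A closure system on a finite set $X$ is a family $\mathcal{C}\subseteq2^X$ with $X,\emptyset\in\mathcal{C}$, closed under intersection, closure operator $\phi(A)=\bigcap\{C\in\mathcal{C}:A\subseteq C\}$; $\mathrm{irr}(x)$ is the family of inclusion-maximal members not containing $x$, $\mathrm{irr}(\mathcal{C})=\bigcup_x\mathrm{irr}(x)$. An implicational base (IB) $(X,\Sigma)$ is a set of implications $A\to B$ ($A,B\subseteq X$ disjoint), whose closed sets are the $C$ with $A\subseteq C\Rightarrow B\subseteq C$ for all $A\to B$; its implication graph has an arc $ab$ when $a\in A,b\in B$ for some $A\to B$; it is acyclic if this graph is, and $\mathrm{anc}(x)$ is the set of $y\neq x$ with a directed path from $y$ to $x$. An acyclic convex geometry is a closure system with an acyclic IB. A minimal generator of $x$ is an inclusion-minimal $A\subseteq X\setminus\{x\}$ with $x\in\phi(A)$; it is critical if $\phi(A)\setminus\{a,x\}\in\mathcal{C}$ for all $a\in A$; $\mathrm{critgen}(x)$ denotes the critical generators of $x$, the critical base is $\{A\to b:A\in\mathrm{critgen}(b)\}$, and $\mathrm{critanc}(x)$ is the ancestor set of $x$ in its implication graph. ACS+A-Enum: given an acyclic IB $(X,\Sigma)$, $x\in X$ and $\mathrm{irr}(y)$ for all $y\in\mathrm{anc}(x)$, list $\mathrm{irr}(x)$ (incremental-polynomial: the $i$-th output within time polynomial in input size plus $i$). CGE+A-Dec: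 given $X$, $\mathrm{irr}(\mathcal{C})$ of an acyclic convex geometry, $x\in X$, $\mathrm{critgen}(y)$ for every $y\in\mathrm{critanc}(x)$, and a family $\mathcal{F}\subseteq\mathrm{critgen}(x)$, answer yes if $\mathcal{F}=\mathrm{critgen}(x)$ and otherwise output some $A\in\mathrm{critgen}(x)\setminus\mathcal{F}$. *)

(* Defs.v *)
From mathcomp Require Import all_boot all_algebra.

Set Implicit Arguments.
Unset Strict Implicit.
Unset Printing Implicit Defensive.

Section ClosureSystems.
Variable T : finType.
Implicit Types (A B M : {set T}) (C : {set {set T}}) (x y : T).

Definition closure_system C : Prop :=
  [/\ setT \in C, set0 \in C & forall A B, A \in C -> B \in C -> A :&: B \in C].

Definition phi C A : {set T} := \bigcap_(B in C | A \subset B) B.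

Definition irr C x : {set {set T}} :=
  [set M | maxset (fun B : {set T} => (B \in C) && (x \notin B)) M].

Definition irr_sys C : {set {set T}} := \bigcup_x irr C x.

Definition implications := {set {set T} * {set T}}.
Implicit Type S : implications.

Definition is_ib S : Prop :=
  forall r, r \in S -> [disjoint r.1 & r.2].

Definition closed_sets S : {set {set T}} :=
  [set M : {set T} | [forall r in S, (r.1 \subset M) ==> (r.2 \subset M)]].

Definition arc S : rel T :=
  fun a b => [exists r in S, (a \in r.1) && (b \in r.2)].

Definition acyclic S : Prop := forall s : seq T, cycle (arc S) s -> s = [::].

Definition anc S x : {set T} := [set y | (y != x) && connect (arc S) y x].

Definition acyclic_convex_geometry C : Prop :=
  closure_system C /\
  exists S : implications, [/\ is_ib S, acyclic S & C = closed_sets S].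

Definition min_generator C x A : bool :=
  minset (fun B : {set T} => (x \notin B) && (x \in phi C B)) A.

Definition critgen C x : {set {set T}} :=
  [set A | min_generator C x A &
           [forall a in A, phi C A :\: [set a; x] \in C]].

Definition critical_base C : implications :=
  [set r | [exists b, (r.2 == [set b]) && (r.1 \in critgen C b)]].

Definition critanc C x : {set T} := anc (critical_base C) x.

End ClosureSystems.

(* Model of computation: the WHILE language over binary trees of N. D. Jones
   (Computability and Complexity from a Programming Perspective), extended with
   an output instruction.  Values are handled by reference, so the unit cost of
   an instruction is a constant for a fixed program, and polynomial time in
   this model is polynomial time on Turing machines. *)

Inductive tree := Leaf | Node of tree & tree.

Fixpoint tsize (t : tree) : nat :=
  if t is Node l r then (tsize l + tsize r).+1 else 1.

Inductive expr :=
  | EVar of nat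
  | ELeaf
  | ENode of expr & expr
  | ELeft of expr
  | ERight of expr.

Inductive cmd :=
  | Assign of nat & expr
  | Emit of expr
  | Seq of cmd & cmd
  | If of expr & cmd & cmd
  | While of expr & cmd.

Definition store := nat -> tree.

Fixpoint eval (s : store) (e : expr) : tree :=
  match e with
  | EVar i => s i
  | ELeaf => Leaf
  | ENode e1 e2 => Node (eval s e1) (eval s e2)
  | ELeft e1 => if eval s e1 is Node l _ then l else Leaf
  | ERight e1 => if eval s e1 is Node _ r then r else Leaf
  end.

Definition upd (s : store) (i : nat) (v : tree) : store :=
  fun j => if j == i then v else s j.

Record config := Config { todo : seq cmd; mem : store; out : seq tree }.

(* A [Leaf] condition is false, a [Node] condition is true. *)
Definition step (k : config) : config :=
  let: Config cs s o := k in
  match cs with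
  | [::] => k
  | Assign i e :: cs => Config cs (upd s i (eval s e)) o
  | Emit e :: cs => Config cs s (rcons o (eval s e))
  | Seq c1 c2 :: cs => Config [:: c1, c2 & cs] s o
  | If e c1 c2 :: cs =>
      Config ((if eval s e is Leaf then c2 else c1) :: cs) s o
  | While e c :: cs =>
      if eval s e is Leaf then Config cs s o
      else Config [:: c, While e c & cs] s o
  end.

(* Variable 0 initially holds the input, the other variables hold [Leaf]. *)
Definition init (P : cmd) (d : tree) : config :=
  Config [:: P] (upd (fun=> Leaf) 0 d) [::].

Definition run (P : cmd) (d : tree) (t : nat) : config :=
  iter t step (init P d).

Definition halts_with (P : cmd) (d : tree) (t : nat) (o : seq tree) : Prop :=
  todo (run P d t) = [::] /\ out (run P d t) = o.

(* The output with index [i] below is the (i+1)-st one. *)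
Definition incremental_time (P : cmd) (p : {poly nat}) (d : tree)
    (o : seq tree) : Prop :=
  (exists t, halts_with P d t o) /\
  forall i, i < size o -> i < size (out (run P d (p.[(tsize d + i.+1)%N])%R)).

Definition poly_time (P : cmd) (p : {poly nat}) (d : tree) (r : tree) : Prop :=
  exists2 t, t <= (p.[tsize d])%R & halts_with P d t [:: r].

(* Encodings: the ground set is 'I_n, elements and n are written in unary,
   sets are characteristic vectors of length n. *)

Definition enc_bool (b : bool) : tree := if b then Node Leaf Leaf else Leaf.

Definition enc_nat (k : nat) : tree := iter k (Node Leaf) Leaf.

Definition enc_seq (U : Type) (enc : U -> tree) (s : seq U) : tree :=
  foldr (fun u t => Node (enc u) t) Leaf s.

Definition enc_pair (U V : Type) (encU : U -> tree) (encV : V -> tree)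
    (uv : U * V) : tree := Node (encU uv.1) (encV uv.2).

Definition enc_set (n : nat) (A : {set 'I_n}) : tree :=
  enc_seq enc_bool [seq i \in A | i <- enum 'I_n].

Definition enc_option (U : Type) (enc : U -> tree) (u : option U) : tree :=
  if u is Some v then Node (enc v) Leaf else Leaf.

Definition enc_elt (n : nat) (x : 'I_n) : tree := enc_nat x.

Definition enc_table (n : nat) (s : seq ('I_n * seq {set 'I_n})) : tree :=
  enc_seq (enc_pair (@enc_elt n) (enc_seq (@enc_set n))) s.

(* [s] lists, in any order and without repetition, the pairs (y, F y) for y
   in D, each F y being itself listed in any order without repetition. *)
Definition tabulates (n : nat) (s : seq ('I_n * seq {set 'I_n}))
    (D : {set 'I_n}) (F : 'I_n -> {set {set 'I_n}}) : Prop :=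
  perm_eq [seq yl.1 | yl <- s] (enum D) /\
  forall yl, yl \in s -> perm_eq yl.2 (enum (F yl.1)).

Record acs_input (n : nat) := AcsInput {
  acs_ib : seq ({set 'I_n} * {set 'I_n});
  acs_x : 'I_n;
  acs_anc : seq ('I_n * seq {set 'I_n}) }.

Definition enc_acs (n : nat) (I : acs_input n) : tree :=
  Node (enc_nat n)
    (Node (enc_seq (enc_pair (@enc_set n) (@enc_set n)) (acs_ib I))
      (Node (enc_elt (acs_x I)) (enc_table (acs_anc I)))).

(* The closure-system condition only says that the empty set is closed. *)
Definition acs_instance (n : nat) (I : acs_input n)
    (S : implications 'I_n) : Prop :=
  [/\ is_ib S, acyclic S, closure_system (closed_sets S),
      perm_eq (acs_ib I) (enum S)
    & tabulates (acs_anc I) (anc S (acs_x I)) (irr (closed_sets S))].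

Definition solves_ACS_A_Enum_incpoly (P : cmd) : Prop :=
  exists p : {poly nat},
  forall (n : nat) (I : acs_input n) (S : implications 'I_n),
    acs_instance I S ->
    exists2 l : seq {set 'I_n},
      perm_eq l (enum (irr (closed_sets S) (acs_x I))) &
      incremental_time P p (enc_acs I) [seq enc_set M | M <- l].

Record cge_input (n : nat) := CgeInput {
  cge_irr : seq {set 'I_n};
  cge_x : 'I_n;
  cge_anc : seq ('I_n * seq {set 'I_n});
  cge_fam : seq {set 'I_n} }.

Definition enc_cge (n : nat) (I : cge_input n) : tree :=
  Node (enc_nat n)
    (Node (enc_seq (@enc_set n) (cge_irr I))
      (Node (enc_elt (cge_x I))
        (Node (enc_table (cge_anc I))
          (enc_seq (@enc_set n) (cge_fam I))))).

Definition cge_instance (n : nat) (I : cge_input n) (C : {set {set 'I_n}})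
    (F : {set {set 'I_n}}) : Prop :=
  [/\ acyclic_convex_geometry C,
      perm_eq (cge_irr I) (enum (irr_sys C)),
      tabulates (cge_anc I) (critanc C (cge_x I)) (critgen C),
      perm_eq (cge_fam I) (enum F)
    & F \subset critgen C (cge_x I)].

(* [None] is the answer "yes". *)
Definition cge_answer (n : nat) (C F : {set {set 'I_n}}) (x : 'I_n)
    (a : option {set 'I_n}) : Prop :=
  if a is Some A then A \in critgen C x :\: F else F = critgen C x.

Definition solves_CGE_A_Dec_poly (P : cmd) : Prop :=
  exists p : {poly nat},
  forall (n : nat) (I : cge_input n) (C F : {set {set 'I_n}}),
    cge_instance I C F ->
    exists2 a : option {set 'I_n},
      cge_answer C F (cge_x I) a &
      poly_time P p (enc_cge I) (enc_option (@enc_set n) a).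

(* Main.v *)
From mathcomp Require Import all_boot all_algebra zify.
Require Import Defs.

(** Let [P = critanc C x].  The implications [A -> y] with [y] in [P] and [A]
    critical for [y], those [A -> x] with [A] in [F], and [P -> x] form an
    acyclic base in which the ancestors of [x] are exactly [P] (this is what the
    rule [P -> x] is for; it is redundant as soon as [F] is not empty).  Maximal
    closed sets avoiding an element of [P] only depend on the rules concluding
    in [P], so they are the members of [irr C y], and the enumeration algorithm
    can be run on this base.  If all sets that it lists belong to [irr C x], then
    [F] is complete.  Otherwise a listed set [M] outside [irr C x] is closed in
    [C] up to [x]; removing greedily extreme points [a] of [K = x |: M] as long
    as [x] is not extreme in [K :\ a] ends with a closed set whose extreme
    points form a critical generator of [x] contained in [M], hence not in [F].
    More than [#|irr_sys C|] outputs cannot all belong to [irr C x], so a run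
    of polynomial length is enough; since only the outputs and not the halting
    time are bounded, the program is run against an explicit unary clock. *)

Set Implicit Arguments.
Unset Strict Implicit.
Unset Printing Implicit Defensive.

(** * Closure systems and critical generators *)

(** One rank function drives the combinatorics: an [r] increasing along the arcs of some base of [C]
    also increases along the critical base and the reduced base, which gives acyclicity and all
    inductions. A missing critical generator [A] is detected because no other critical generator of
    [x] fits inside [phi C A :\ x]: that set stays closed under the reduced rules, so some maximal
    set contains [A] and cannot be closed in [C]. This needs a member of [F], which keeps [P] from
    fitting there too and makes [P -> x] valid in [C]. So [F = set0] is decided apart: [x] has a
    critical generator exactly when it has a critical ancestor. The case [P \in F] is also apart:
    every critical generator of [x] lies in [P], so [F] is complete, whereas the rule [P -> x] would
    be listed twice. On the machine side, values are shared, so a short run may build an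
    exponentially large tree; hence polynomial-time functions carry a size bound besides a time
    bound, and loops require a bound on their accumulators. *)

Section ClosureFacts.
Variables (T : finType) (C : {set {set T}}).
Hypothesis Ccs : closure_system C.
Implicit Types (A B K M N : {set T}) (x y : T).

Lemma phi_closed A : phi C A \in C.
Proof.
case: Ccs => CT _ CI; rewrite /phi.
by apply: (big_ind (fun B => B \in C)) => // B /andP[].
Qed.

Lemma sub_phi A : A \subset phi C A.
Proof. by apply/bigcapsP => B /andP[]. Qed.

Lemma phi_min A K : K \in C -> A \subset K -> phi C A \subset K.
Proof. by move=> KC AK; apply: bigcap_inf; rewrite KC. Qed.

Lemma irrP x M :
  reflect [/\ M \in C, x \notin M &
    forall K, K \in C -> x \notin K -> M \subset K -> K = M]
    (M \in irr C x).
Proof.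
rewrite inE; apply: (iffP maxsetP) => [[/andP[MC xM] maxM]|[MC xM maxM]].
  by split=> // K KC xK MK; apply: maxM; rewrite ?KC.
by rewrite MC xM; split=> // K /andP[KC xK]; apply: maxM.
Qed.

Lemma irr_extend K x : K \in C -> x \notin K ->
  exists2 M, M \in irr C x & K \subset M.
Proof.
move=> KC xK.
have [|M maxM KM] := @maxset_exists _ (fun B => (B \in C) && (x \notin B)) K.
  by rewrite KC.
by exists M; rewrite ?inE.
Qed.

Lemma irr_sub_sys x : irr C x \subset irr_sys C.
Proof. exact: bigcup_sup. Qed.

Lemma irr_sysW M : M \in irr_sys C -> M \in C.
Proof. by case/bigcupP => x _ /irrP[]. Qed.

(** This is the closedness test available when only the irreducible sets are listed. A closed [K]
    avoiding [y] extends to a maximal one; conversely the separating sets show that [phi C K] adds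
    nothing to [K]. *)
Lemma closed_by_irr K :
  (K \in C) = [forall y, (y \in K) ||
     [exists N in irr_sys C, (K \subset N) && (y \notin N)]].
Proof.
apply/idP/forallP => [KC y|sepK].
  have [//|yK /=] := boolP (y \in K).
  have [M Mirr KM] := irr_extend KC yK.
  apply/existsP; exists M; rewrite KM (subsetP (irr_sub_sys y)) //.
  by have /irrP[] := Mirr.
suff -> : K = phi C K by exact: phi_closed.
apply/eqP; rewrite eqEsubset sub_phi; apply/subsetP => y yphi.
have /orP[//|/existsP[N /and3P[/irr_sysW NC KN]]] := sepK y.
by rewrite (subsetP (phi_min NC KN)).
Qed.

(** Maximality may be tested against irreducible sets alone, since any larger closed set avoiding
    [y] extends to one. This makes [irr C y] computable from the list. *)
Lemma irr_by_sys y N :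
  (N \in irr C y) = [&& N \in irr_sys C, y \notin N &
    [forall N' in irr_sys C,
       (y \in N') || ~~ (N \subset N') || (N' \subset N)]].
Proof.
apply/idP/and3P => [Nirr|[Nsys yN /forallP maxN]].
  have /irrP[NC yN maxN] := Nirr; split=> //.
    exact: subsetP (irr_sub_sys y) _ Nirr.
  apply/forallP=> N'; apply/implyP => /irr_sysW N'C.
  have [//|yN'] := boolP (y \in N'); rewrite ?orbF /=.
  have [NN'|//] := boolP (N \subset N').
  by rewrite (maxN N' N'C yN' NN') subxx.
have [M Mirr NM] := irr_extend (irr_sysW Nsys) yN.
have /irrP[_ yM _] := Mirr.
have /implyP/(_ (subsetP (irr_sub_sys y) _ Mirr)) := maxN M.
rewrite (negPf yM) NM /= => MN.
by rewrite (_ : N = M) //; apply/eqP; rewrite eqEsubset NM.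
Qed.

Lemma min_generatorP x A :
  reflect [/\ x \notin A, x \in phi C A &
    forall B, B \subset A -> x \in phi C B -> B = A]
    (min_generator C x A).
Proof.
apply: (iffP minsetP) => [[/andP[xA xphi] minA]|[xA xphi minA]].
  split=> // B BA xB; apply: minA => //; rewrite xB andbT.
  by apply: contra xA; apply: (subsetP BA).
by rewrite xA xphi; split=> // B /andP[_ xB] BA; apply: minA.
Qed.

Lemma critgenP x A :
  reflect [/\ x \notin A, x \in phi C A,
    forall B, B \subset A -> x \in phi C B -> B = A &
    forall a, a \in A -> phi C A :\: [set a; x] \in C]
    (A \in critgen C x).
Proof.
rewrite inE; apply: (iffP andP) => [[/min_generatorP[xA xp mA]]|[xA xp mA cA]].
  by move=> /forallP cA; split=> // a aA; apply: (implyP (cA a)).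
split; first by apply/min_generatorP.
by apply/forallP => a; apply/implyP; apply: cA.
Qed.

Lemma critgen_neq0 x A : A \in critgen C x -> A != set0.
Proof.
case/critgenP => xA xphi _ _; apply/eqP => A0; have [_ C0 _] := Ccs.
by have := subsetP (phi_min C0 (sub0set set0)) x; rewrite -A0 xphi A0 inE => /(_ isT).
Qed.

Lemma critgen_sub_eq x A B :
  A \in critgen C x -> B \in critgen C x -> A \subset B -> A = B.
Proof. by move=> /critgenP[_ xA _ _] /critgenP[_ _ mB _] AB; apply: mB. Qed.

(** If some [a] of [A] is missing from [B], then [B] lies in [phi C A :\: [set a; x]], which
    criticality makes closed although it avoids [x]. Otherwise [A \subset B] and minimality
    applies. *)
Lemma critgen_sub_phi x A B : A \in critgen C x -> B \in critgen C x ->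
  B \subset phi C A :\ x -> A = B.
Proof.
move=> Ac Bc BA; have /critgenP[_ _ mA cA] := Ac.
have [AB|/subsetPn[a aA aB]] := boolP (A \subset B).
  exact: critgen_sub_eq Ac Bc AB.
have BK : B \subset phi C A :\: [set a; x].
  apply/subsetP => b bB; have := subsetP BA b bB; rewrite !inE.
  have [ba|//] := eqVneq b a; by rewrite -ba bB in aB.
have /critgenP[_ xB _ _] := Bc.
by have := subsetP (phi_min (cA _ aA) BK) x xB; rewrite !inE eqxx orbT.
Qed.

(** * Greedy removal of extreme points *)

Definition ext K := [set a in K | K :\ a \in C].

(** The last test says that [x] is still not extreme once [a] is gone. *)
Definition gstep x K a :=
  if [&& a != x, a \in K, K :\ a \in C & K :\: [set a; x] \notin C]
  then K :\ a else K.

Definition gpass x K := foldl (gstep x) K (enum T).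

(** A removal can make points seen earlier in the pass removable, hence the repeated passes; [#|T|]
    of them suffice because each pass that is not idle loses a point. *)
Definition greedy x K := iter #|T| (gpass x) K.

Definition nonext x K := [&& K \in C, x \in K & K :\ x \notin C].

Lemma gstep_sub x K a : gstep x K a \subset K.
Proof. by rewrite /gstep; case: ifP => // _; apply: subsetDl. Qed.

Lemma gstep_nonext x K a : nonext x K -> nonext x (gstep x K a).
Proof.
rewrite /gstep; case: ifP => // /and4P[ax aK KaC KaxC] /and3P[KC xK KxC].
by rewrite /nonext KaC !inE xK eq_sym ax /= setDDl.
Qed.

Lemma gpass_sub x K s : foldl (gstep x) K s \subset K.
Proof.
elim: s K => //= a s IH K; exact: subset_trans (IH _) (gstep_sub _ _ _).
Qed.

Lemma gpass_nonext x K s : nonext x K -> nonext x (foldl (gstep x) K s).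
Proof. by elim: s K => //= a s IH K nK; apply/IH/gstep_nonext. Qed.

Lemma gpass_fix x K s a :
  foldl (gstep x) K s = K -> a \in s -> gstep x K a = K.
Proof.
elim: s => //= b s IH fixK.
have gb : gstep x K b = K.
  apply/eqP; rewrite eqEsubset gstep_sub /= -{1}fixK; exact: gpass_sub.
by rewrite inE => /orP[/eqP -> //|]; apply: IH; rewrite -{1}gb.
Qed.

Lemma greedy_sub x K : greedy x K \subset K.
Proof.
rewrite /greedy; elim: #|T| => //= n IH; exact: subset_trans (gpass_sub _ _ _) IH.
Qed.

Lemma greedy_nonext x K : nonext x K -> nonext x (greedy x K).
Proof. by move=> nK; rewrite /greedy; elim: #|T| => //= n; apply: gpass_nonext. Qed.

Lemma gpass_greedy x K : gpass x (greedy x K) = greedy x K.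
Proof.
have progress n : #|iter n (gpass x) K| + n <= #|K|
    \/ gpass x (iter n (gpass x) K) = iter n (gpass x) K.
  elim: n => [|n [IH|fixn]]; [by left; rewrite addn0| |by right; rewrite /= !fixn].
  have := gpass_sub x (iter n (gpass x) K) (enum T); rewrite -/(gpass x _).
  rewrite subEproper => /orP[/eqP fixn|/proper_card lt].
    by right; rewrite /= !fixn.
  by left; rewrite /=; lia.
case: (progress #|T|) => // card_le; have cardK : #|K| <= #|T| := max_card _.
(* In the remaining case each of the [#|T|] passes has lost a point, so nothing is left. *)
have g0 : greedy x K = set0 by apply/eqP; rewrite -cards_eq0 /greedy; lia.
by apply/eqP; rewrite g0 -subset0 gpass_sub.
Qed.

End ClosureFacts.

(** * Ranked bases and locality of maximal closed sets *)

Section Rank.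
Variable T : finType.
Implicit Types (S : implications T) (A B K M : {set T}) (x y : T).

Definition ranks S (r : T -> nat) := forall a b, arc S a b -> r a < r b.

(** The rank counts ancestors: along an arc from [a] to [b] the ancestors of [a] remain ancestors of
    [b], and [a] is a new one, since a return path would close a cycle. *)
Lemma acyclic_ranks S : acyclic S -> exists r, ranks S r.
Proof.
move=> acS; exists (fun b => #|anc S b|) => a b ab; apply: proper_card.
have no_back z : connect (arc S) b z -> arc S z b -> False.
  move=> /connectP[p pth ez] zb.
  by have := acS (b :: p); rewrite /= rcons_path pth -ez zb => /(_ isT).
have ne z : arc S z b -> z != b.
  by move=> zb; apply/eqP => e; apply: (no_back z) => //; rewrite e connect0.
apply/properP; split.
  apply/subsetP => z; rewrite !inE => /andP[_ za].
  rewrite (connect_trans za (connect1 ab)) andbT.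
  by apply/eqP => e; apply: (no_back a) => //; rewrite -e.
by exists a; rewrite !inE ?eqxx // ne ?connect1.
Qed.

Lemma ranks_connect S r a b : ranks S r -> connect (arc S) a b -> r a <= r b.
Proof.
move=> rS /connectP[p]; elim: p a => /= [a _ -> //|c p IH a /andP[ac pth] eb].
exact: leq_trans (ltnW (rS _ _ ac)) (IH _ pth eb).
Qed.

Lemma ranks_acyclic S r : ranks S r -> acyclic S.
Proof.
move=> rS [//|a p]; rewrite /= rcons_path => /andP[pth la].
have := ranks_connect rS (a := a) (b := last a p).
rewrite leqNgt (rS _ _ la) => /(_ _)/negP; case=> //.
by apply/connectP; exists p.
Qed.

Lemma closed_setsP S M :
  reflect (forall r, r \in S -> r.1 \subset M -> r.2 \subset M)
          (M \in closed_sets S).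
Proof.
rewrite inE; apply: (iffP forallP) => cM r; last first.
  by apply/implyP => rS; apply/implyP; apply: cM.
by move=> rS; have /implyP/(_ rS)/implyP := cM r.
Qed.

Lemma closed_sets_system S :
  (forall r, r \in S -> r.1 != set0) -> closure_system (closed_sets S).
Proof.
move=> nz; split.
- by apply/closed_setsP => r _ _; apply: subsetT.
- by apply/closed_setsP => r /nz; rewrite subset0 => /negPf ->.
move=> A B /closed_setsP cA /closed_setsP cB; apply/closed_setsP => r rS.
by rewrite !subsetI => /andP[/(cA _ rS) -> /(cB _ rS) ->].
Qed.

Lemma arc_intro S r a b : r \in S -> a \in r.1 -> b \in r.2 -> arc S a b.
Proof. by move=> rS ar br; apply/existsP; exists r; rewrite rS ar br. Qed.

(** Adding all of [~: P] to [M] breaks no rule: one that concludes in [P] has its premise in [P], so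
    a premise satisfied after the addition was satisfied before. As [y] is still avoided, maximality
    absorbs the addition. *)
Lemma irr_local_sub S (P : {set T}) y M : y \in P ->
  (forall r, r \in S -> ~~ [disjoint r.2 & P] -> r.1 \subset P) ->
  M \in irr (closed_sets S) y -> ~: P \subset M.
Proof.
move=> yP localP /irrP[/closed_setsP cM yM maxM].
suff <- : M :|: ~: P = M by apply: subsetUr.
apply: maxM; rewrite ?subsetUl //; last by rewrite !inE yP orbF.
apply/closed_setsP => r rS r1; apply/subsetP => b b2; rewrite !inE.
have [bP|] := boolP (b \in P); rewrite ?orbT // orbF.
have r1P : r.1 \subset P.
  by apply: localP => //; apply/pred0Pn; exists b; apply/andP.
apply: (subsetP (cM _ rS _)) b2; apply/subsetP => a ar.
by have := subsetP r1 a ar; rewrite !inE (subsetP r1P) ?orbF.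
Qed.

(** Members of either family contain [~: P], and so do the closed sets they are compared with; there
    the two systems agree. *)
Lemma irr_local S1 S2 (P : {set T}) y : y \in P ->
  (forall r, r \in S1 -> ~~ [disjoint r.2 & P] -> r.1 \subset P) ->
  (forall r, r \in S2 -> ~~ [disjoint r.2 & P] -> r.1 \subset P) ->
  (forall M, ~: P \subset M -> (M \in closed_sets S1) = (M \in closed_sets S2)) ->
  irr (closed_sets S1) y = irr (closed_sets S2) y.
Proof.
move=> yP loc1 loc2 agree; apply/setP => M.
wlog suff sub : S1 S2 loc1 loc2 agree /
    M \in irr (closed_sets S1) y -> M \in irr (closed_sets S2) y.
  by apply/idP/idP; apply: sub => // N PN; rewrite agree.
move=> Mirr; have PM := irr_local_sub yP loc1 Mirr.
have /irrP[cM yM maxM] := Mirr; apply/irrP; split; rewrite -?agree //.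
by move=> K cK yK MK; apply: maxM => //; rewrite agree // (subset_trans PM).
Qed.

(** * Extreme points and the critical base of an acyclic convex geometry *)

Section ConvexGeometry.
Variables (S : implications T) (r : T -> nat).
Hypothesis rS : ranks S r.
Let C := closed_sets S.
Hypothesis Ccs : closure_system C.

(** By induction on rank: if [d] is not extreme, some rule broken by [K :\ d] concludes [d] from
    lower-ranked points of [K], which are already generated. *)
Lemma sub_phi_ext K : K \in C -> K \subset phi C (ext C K).
Proof.
move=> KC; suff gen n d : r d < n -> d \in K -> d \in phi C (ext C K).
  by apply/subsetP => d; apply: (gen (r d).+1).
elim: n d => // n IH d rd dK.
have [KdC|/closed_setsP nKd] := boolP (K :\ d \in C).
  by apply: (subsetP (sub_phi C _)); rewrite inE dK.
apply/negPn/negP => dphi; apply: nKd => q qS q1.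
have qK : q.2 \subset K.
  have /closed_setsP := KC; apply => //; exact: subset_trans q1 (subsetDl _ _).
apply/subsetP => e e2; rewrite !inE (subsetP qK) // andbT.
apply: contra dphi => /eqP ed; have d2 : d \in q.2 by rewrite -ed.
have /closed_setsP := phi_closed Ccs (ext C K) => /(_ _ qS) sub.
apply: (subsetP (sub _) d d2); apply/subsetP => a a1.
apply: IH; last by have := subsetP q1 a a1; rewrite !inE => /andP[].
by apply: leq_trans (rS (arc_intro qS a1 d2)) _.
Qed.

(** At a fixpoint each extreme [a] has [K :\: [set a; x]] closed. This is criticality, and it also
    gives minimality: a set of extreme points missing [a] generates at most that set. *)
Lemma ext_critgen x K : nonext C x K ->
  (forall a, gstep C x K a = K) -> ext C K \in critgen C x.
Proof.
move=> /and3P[KC xK KxC] fixK.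
have phiE : phi C (ext C K) = K.
  apply/eqP; rewrite eqEsubset sub_phi_ext // andbT.
  by apply: phi_min => //; apply/subsetP => a; rewrite inE => /andP[].
have crit a : a \in ext C K -> K :\: [set a; x] \in C.
  rewrite inE => /andP[aK KaC]; have := fixK a; rewrite /gstep aK KaC.
  have [ax|ax /=] := eqVneq a x; first by rewrite -ax setUid.
  by case: ifP => [_ /setP/(_ a)|/negbT]; rewrite ?inE ?eqxx ?aK // negbK.
apply/critgenP; split.
- by rewrite inE (negPf KxC) andbF.
- by rewrite phiE.
- move=> B Bsub xB; apply/eqP; rewrite eqEsubset Bsub.
  apply/subsetP => a aE; apply/negPn/negP => aB.
  have BK : B \subset K :\: [set a; x].
    apply/subsetP => b bB; have bE := subsetP Bsub b bB.
    rewrite !inE; move: (bE); rewrite inE => /andP[bK KbC]; rewrite bK andbT.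
    apply/norP; split; first by apply: contraNneq aB => <-.
    by apply: contraNneq KxC => <-.
  have := subsetP (phi_min (crit _ aE) BK) x xB.
  by rewrite !inE eqxx orbT.
by rewrite phiE.
Qed.

Lemma ext_greedy_critgen x K : nonext C x K ->
  ext C (greedy C x K) \in critgen C x.
Proof.
move=> nK; apply: ext_critgen; first exact: greedy_nonext.
by move=> a; apply: (gpass_fix (s := enum T) (gpass_greedy C x K)); rewrite mem_enum.
Qed.

Lemma ext_greedy_sub x K : nonext C x K -> ext C (greedy C x K) \subset K :\ x.
Proof.
move=> nK; have /and3P[_ _ gx] := greedy_nonext nK.
apply/subsetP => a; rewrite inE => /andP[ag gaC].
rewrite in_setD1 (subsetP (greedy_sub C x K)) // andbT.
by apply: contraNneq gx => ax; rewrite ax in gaC.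
Qed.

(** The points of [A] ranked below [b] already generate [b], so minimality leaves no others. *)
Lemma min_generator_rank b A a :
  min_generator C b A -> a \in A -> r a < r b.
Proof.
case/min_generatorP => bA bphi minA aA.
pose A' := [set a in A | r a < r b].
suff bA' : b \in phi C A'.
  have A'A : A' \subset A by apply/subsetP => c; rewrite inE => /andP[].
  by have := aA; rewrite -(minA A') // inE => /andP[].
(* Points of rank at least [r b], except [b], can be added for free: a rule concluding a point
   outside them, which has rank at most [r b], has premises of smaller rank. *)
pose M := phi C A' :|: [set z | (r b <= r z) && (z != b)].
have MC : M \in C.
  apply/closed_setsP => q qS q1; apply/subsetP => c c2; rewrite !inE.
  have [//|nc] := boolP ((r b <= r c) && (c != b)); rewrite ?orbT // orbF.
  have rc : r c <= r b.
    by move: nc; rewrite negb_and negbK -ltnNge => /orP[/ltnW|/eqP ->].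
  have /closed_setsP/(_ _ qS) sub := phi_closed Ccs A'.
  apply: (subsetP (sub _) c c2); apply/subsetP => d d1.
  have := subsetP q1 d d1; rewrite !inE => /orP[//|/andP[]].
  by have := rS (arc_intro qS d1 c2); lia.
have AM : A \subset M.
  apply/subsetP => c cA; rewrite !inE.
  have [rc|rc] := ltnP (r c) (r b).
    by rewrite (subsetP (sub_phi C A')) // inE cA.
  by rewrite orbC /=; apply/orP; left; apply: contraNneq bA => <-.
by have := subsetP (phi_min MC AM) b bphi; rewrite !inE eqxx andbF orbF.
Qed.

Lemma critgen_rank b A a : A \in critgen C b -> a \in A -> r a < r b.
Proof. by rewrite inE => /andP[mA _]; apply: min_generator_rank. Qed.

Lemma critical_base_ranks : ranks (critical_base C) r.
Proof.
move=> a b /existsP[q /and3P[]]; rewrite inE => /existsP[c /andP[/eqP -> qc]].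
by move=> aq; rewrite inE => /eqP ->; apply: critgen_rank qc aq.
Qed.

(** A point [d] of least rank in [phi C M] outside [M] is not extreme in [phi C M]. The greedy
    removal then yields a critical generator of [d] whose points rank lower, hence lie in [M]. So
    the critical base is indeed a base of [C]. *)
Lemma closed_by_critgen M :
  reflect (forall y A, A \in critgen C y -> A \subset M -> y \in M) (M \in C).
Proof.
apply: (iffP idP) => [MC y A /critgenP[_ yA _ _] AM|cM].
  exact: subsetP (phi_min MC AM) y yA.
suff le n d : r d < n -> d \in phi C M -> d \in M.
  suff -> : M = phi C M by apply: phi_closed.
  apply/eqP; rewrite eqEsubset sub_phi; apply/subsetP => d.
  exact: (le (r d).+1).
elim: n d => // n IH d rd dphi; apply/negPn/negP => dM.
have ne : nonext C d (phi C M).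
  rewrite /nonext phi_closed // dphi; apply/negP => cl.
  have Msub : M \subset phi C M :\ d by rewrite subsetD1 sub_phi.
  by have := subsetP (phi_min cl Msub) d dphi; rewrite !inE eqxx.
have crit := ext_greedy_critgen ne; move/negP: dM; apply.
apply: (cM _ _ crit); apply/subsetP => a aE; apply: IH.
  exact: leq_trans (critgen_rank crit aE) _.
by have := subsetP (ext_greedy_sub ne) a aE; rewrite !inE => /andP[].
Qed.

Lemma critgen_arc y A a :
  A \in critgen C y -> a \in A -> arc (critical_base C) a y.
Proof.
move=> Ac aA; apply: (arc_intro (r := (A, [set y]))); rewrite ?inE //=.
by apply/existsP; exists y; rewrite eqxx.
Qed.

(** * The reduced base and its maximal closed sets avoiding [x] *)

Section Reduction.
Variables (x : T) (F : {set {set T}}) (S' : implications T).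
Let P := critanc C x.
Hypothesis Fcrit : F \subset critgen C x.
Hypothesis F_neq0 : F != set0.
Hypothesis S'P : forall q, reflect
  [\/ exists y, [/\ y \in P, q.2 = [set y] & q.1 \in critgen C y],
      q.2 = [set x] /\ q.1 \in F | q = (P, [set x])] (q \in S').
Let C' := closed_sets S'.

Lemma notin_critanc : x \notin P.
Proof. by rewrite !inE eqxx. Qed.

Lemma critgen_sub_critanc y A :
  y \in x |: P -> A \in critgen C y -> A \subset P.
Proof.
move=> yP Ac; apply/subsetP => a aA; have ay := critgen_arc Ac aA.
have yx : connect (arc (critical_base C)) y x.
  by move: yP; rewrite !inE => /orP[/eqP ->|/andP[]//]; apply: connect0.
rewrite inE (connect_trans (connect1 ay) yx) andbT.
apply: contraTneq (ranks_connect critical_base_ranks yx) => <-.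
by rewrite -ltnNge; apply: critical_base_ranks.
Qed.

Lemma critanc_rank y : y \in P -> r y < r x.
Proof.
rewrite inE => /andP[yx /connectP[[|z p] /= pth ex]].
  by rewrite ex eqxx in yx.
case/andP: pth => yz pth; apply: leq_trans (critical_base_ranks yz) _.
by apply: (ranks_connect critical_base_ranks); apply/connectP; exists p.
Qed.

Lemma premise_sub q : q \in S' -> q.1 \subset P.
Proof.
case/S'P => [[y [yP _ qc]]|[_ qF]|-> //].
  by apply: critgen_sub_critanc qc; rewrite inE yP orbT.
by apply: (critgen_sub_critanc (y := x)); rewrite ?setU11 ?(subsetP Fcrit).
Qed.

(** Nonempty premises make the empty set closed, as an instance demands. For [P] this comes from a
    member of [F], which is contained in [P]. *)
Lemma premise_neq0 q : q \in S' -> q.1 != set0.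
Proof.
move=> qS; have [A AF] := set0Pn _ F_neq0.
have Ac := subsetP Fcrit _ AF.
case/S'P: qS => [[y [_ _ /critgen_neq0]]|[_ qF]|->] /=; first exact.
  exact: (critgen_neq0 Ccs (subsetP Fcrit _ qF)).
have AP := critgen_sub_critanc (setU11 _ _) Ac.
apply: contraNneq (critgen_neq0 Ccs Ac) => P0.
by rewrite -subset0 -P0.
Qed.

Lemma reduction_ranks : ranks S' r.
Proof.
move=> a b /existsP[q /and3P[qS aq]].
case/S'P: (qS) => [[y [yP -> qc]]|[-> _]|e].
- by rewrite inE => /eqP ->; apply: critgen_rank qc aq.
- rewrite inE => /eqP ->; apply: critanc_rank.
  exact: subsetP (premise_sub qS) a aq.
rewrite {1}e inE => /eqP ->; apply: critanc_rank.
exact: subsetP (premise_sub qS) a aq.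
Qed.

Lemma reduction_acyclic : acyclic S'.
Proof. exact: ranks_acyclic reduction_ranks. Qed.

Lemma reduction_ib : is_ib S'.
Proof.
move=> q qS; rewrite disjoint_subset; apply/subsetP => a a1; apply/negP => a2.
by have := reduction_ranks (arc_intro qS a1 a2); rewrite ltnn.
Qed.

Lemma reduction_system : closure_system C'.
Proof. exact: closed_sets_system premise_neq0. Qed.

Lemma reduction_anc : anc S' x = P.
Proof.
apply/setP => y; apply/idP/idP => [|yP]; last first.
  have xS : (P, [set x]) \in S' by apply/S'P; constructor 3.
  rewrite inE; apply/andP; split; first by apply: contraNneq notin_critanc => <-.
  by apply/connect1/(arc_intro xS); rewrite //= inE.
rewrite inE => /andP[yx /connectP[[|z p] /= pth ex]].
  by rewrite ex eqxx in yx.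
case/andP: pth => /existsP[q /and3P[qS yq _]] _.
exact: subsetP (premise_sub qS) y yq.
Qed.

Lemma reduction_closedP M : reflect
  [/\ forall y A, y \in P -> A \in critgen C y -> A \subset M -> y \in M,
      forall A, A \in F -> A \subset M -> x \in M & P \subset M -> x \in M]
  (M \in C').
Proof.
apply: (iffP (closed_setsP _ _)) => [cM|[cP cF cx] q].
  split=> [y A yP Ac AM|A AF AM|PM].
  - suff : [set y] \subset M by rewrite sub1set.
    by apply: (cM (A, [set y])) => //; apply/S'P; constructor 1; exists y.
  - suff : [set x] \subset M by rewrite sub1set.
    by apply: (cM (A, [set x])) => //; apply/S'P; constructor 2.
  suff : [set x] \subset M by rewrite sub1set.
  by apply: (cM (P, [set x])) => //; apply/S'P; constructor 3.
case/S'P => [[y [yP -> qc]]|[-> qF]|->] /=; rewrite sub1set //.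
  exact: cP qc.
exact: cF qF.
Qed.

Lemma sub_reduction : C \subset C'.
Proof.
apply/subsetP => M /closed_by_critgen cM; apply/reduction_closedP; split.
- by move=> y A _; apply: cM.
- by move=> A AF; apply: cM; apply: subsetP Fcrit _ AF.
have [A AF] := set0Pn _ F_neq0; have Ac := subsetP Fcrit _ AF.
move=> PM; apply: (cM x A) => //; apply: subset_trans PM.
by apply: critgen_sub_critanc Ac; rewrite setU11.
Qed.

Lemma critical_base_closed : C = closed_sets (critical_base C).
Proof.
apply/setP => M; apply/closed_by_critgen/closed_setsP => [cM q|cM y A Ac AM].
  rewrite inE => /existsP[b /andP[/eqP -> qc]] q1; rewrite sub1set.
  exact: cM qc q1.
suff : [set y] \subset M by rewrite sub1set.
by apply: (cM (A, [set y])) => //; rewrite inE; apply/existsP; exists y; rewrite eqxx.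
Qed.

Lemma reduction_irr y : y \in P -> irr C' y = irr C y.
Proof.
move=> yP; rewrite critical_base_closed; apply: (irr_local (P := P)) => //.
- by move=> q qS _; apply: premise_sub.
- move=> q; rewrite inE => /existsP[b /andP[/eqP -> qc]].
  case/pred0Pn => c /andP[/= ]; rewrite inE => /eqP -> bP.
  by apply: critgen_sub_critanc qc; rewrite inE bP orbT.
(* A set containing [~: P] satisfies every rule that concludes outside [P], in particular those for
   [x]; the two bases have the same rules into [P]. *)
move=> M PM; rewrite -critical_base_closed.
have xM : x \in M by apply: (subsetP PM); rewrite inE notin_critanc.
apply/reduction_closedP/closed_by_critgen => [[cP _ _] z A Ac AM|cM].
  have [zP|zP] := boolP (z \in P); first exact: cP Ac AM.
  by apply: (subsetP PM); rewrite inE.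
by split=> // z A _; apply: cM.
Qed.

Lemma reduction_complete : irr C' x \subset irr C x -> F = critgen C x.
Proof.
move=> sub; apply/eqP; rewrite eqEsubset Fcrit /=.
apply/subsetP => A Ac; apply/negPn/negP => AF.
pose K := phi C A :\ x.
have noF B : B \in F -> B \subset K -> False.
  move=> BF BK; move: AF; rewrite (critgen_sub_phi Ac _ BK) ?BF //.
  exact: subsetP Fcrit _ BF.
have [B BF] := set0Pn _ F_neq0; have Bc := subsetP Fcrit _ BF.
(* Rules into [P] survive because [phi C A] is closed and only [x], a point outside [P], was
   removed. *)
have KC : K \in C'.
  apply/reduction_closedP; split=> [y D yP Dc DK|D DF /(noF _ DF)//|PK].
    have yx : y != x by apply: contraNneq notin_critanc => <-.
    rewrite !inE yx /=; have /closed_by_critgen cl := phi_closed Ccs A.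
    by apply: (cl y D) => //; apply: subset_trans DK (subsetDl _ _).
  case: (noF _ BF); apply: subset_trans PK.
  by apply: critgen_sub_critanc Bc; rewrite setU11.
have [|M Mirr KM] := irr_extend KC (x := x); first by rewrite !inE eqxx.
have /irrP[MC xM _] := subsetP sub _ Mirr.
have /critgenP[xA xphi _ _] := Ac.
have AM : A \subset M.
  by apply: subset_trans KM; rewrite subsetD1 sub_phi.
by rewrite (subsetP (phi_min MC AM)) in xM.
Qed.

(** [M] is not closed in [C]: its maximality in the larger [C'] would put it in [irr C x]. Adding
    [x] repairs it, since everything outside [x |: P] is in [M], and rules into [P] have premises in
    [P], which avoid [x]. *)
Lemma reduction_nonext M :
  M \in irr C' x -> M \notin irr C x -> nonext C x (x |: M).
Proof.
move=> Mirr MN; have /irrP[MC' xM maxM] := Mirr.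
have PM : ~: (x |: P) \subset M.
  apply: irr_local_sub Mirr; rewrite ?setU11 // => q qS _.
  exact: subset_trans (premise_sub qS) (subsetUr _ _).
have /reduction_closedP[cP _ _] := MC'.
rewrite /nonext setU11 setU1K //=; apply/andP; split.
  apply/closed_by_critgen => y A Ac AM; rewrite inE.
  have [yP|yP] := boolP (y \in x |: P); last first.
    by rewrite (subsetP PM) ?inE ?orbT //; move: yP; rewrite !inE.
  move: (yP); rewrite [y \in x |: P]inE; case/orP => [->//|yP'].
  rewrite (cP y A) ?orbT //.
  have AP := critgen_sub_critanc yP Ac.
  apply/subsetP => a aA; have := subsetP AM a aA; rewrite !inE.
  by case: eqP => // e; case/negP: notin_critanc; rewrite -e (subsetP AP).
apply: contra MN => MC; apply/irrP; split=> // K KC.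
by apply: maxM; apply: subsetP sub_reduction _ KC.
Qed.

Lemma reduction_new M A : M \in irr C' x -> A \subset M -> A \notin F.
Proof.
move=> /irrP[/reduction_closedP[_ cF _] xM _] AM.
by apply: contra xM => AF; apply: cF AM.
Qed.

End Reduction.

Lemma critgen_nonext x : critgen C x != set0 -> nonext C x setT.
Proof.
case/set0Pn => A Ac; have [CT _ _] := Ccs; rewrite /nonext CT inE /=.
have /critgenP[xA _ _ _] := Ac; apply/negP => /closed_by_critgen/(_ x A Ac).
by rewrite subsetD1 subsetT xA !inE eqxx => /(_ isT).
Qed.

(** The last arc of a path to [x] in the critical base comes from a critical generator of [x]. For
    empty [F] this tells from the input table whether a generator exists. *)
Lemma critgen_eq0 x : (critgen C x == set0) = (critanc C x == set0).
Proof.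
apply/eqP/eqP => [c0|P0].
  apply/setP => y; rewrite inE; apply/negP; rewrite inE => /andP[yx].
  case/connectP => p; elim/last_ind: p => [_ e|p z _]; first by rewrite e eqxx in yx.
  rewrite rcons_path last_rcons => /andP[_ az] e; move: az; rewrite -e.
  case/existsP => q /and3P[]; rewrite inE => /existsP[b /andP[/eqP -> qc]] _.
  by rewrite inE => /eqP xb; rewrite -xb c0 inE in qc.
apply/eqP/negPn/negP => /set0Pn[A Ac].
have := critgen_sub_critanc (setU11 x _) Ac.
by rewrite P0 subset0; apply/negP; apply: critgen_neq0 Ac.
Qed.

End ConvexGeometry.
End Rank.

(** * Trees read as lists, and their sizes *)

Definition tleft (t : tree) := if t is Node l _ then l else Leaf.
Definition tright (t : tree) := if t is Node _ r then r else Leaf.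
Definition isnode (t : tree) := if t is Node _ _ then true else false.

(* A tree is read as the list of the left subtrees along its right spine. *)
Fixpoint tseq (t : tree) : seq tree := if t is Node a u then a :: tseq u else [::].
Definition tlist : seq tree -> tree := foldr Node Leaf.

Lemma tlistK : cancel tlist tseq.
Proof. by elim=> //= a s ->. Qed.

Lemma tseqK : cancel tseq tlist.
Proof. by elim=> //= a _ u ->. Qed.

Lemma enc_seqE U (enc : U -> tree) s : enc_seq enc s = tlist (map enc s).
Proof. by elim: s => //= u s ->. Qed.

Lemma enc_nat_list k : enc_nat k = tlist (nseq k Leaf).
Proof. by elim: k => //= k ->. Qed.

Lemma tsize_gt0 t : 0 < tsize t.
Proof. by case: t. Qed.

Lemma tsize_left t : tsize (tleft t) <= tsize t.
Proof. by case: t => //= l r; lia. Qed.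

Lemma tsize_right t : tsize (tright t) <= tsize t.
Proof. by case: t => //= l r; lia. Qed.

Lemma size_tseq t : size (tseq t) < tsize t.
Proof. by elim: t => //= l _ r; lia. Qed.

Lemma tsize_enc_nat k : tsize (enc_nat k) = k.*2.+1.
Proof. by elim: k => //= k ->; lia. Qed.

Lemma tsize_list s : tsize (tlist s) = (\sum_(e <- s) (tsize e).+1).+1.
Proof.
elim: s => [|a s IH]; first by rewrite big_nil.
by rewrite big_cons /= -/(tlist s) IH; lia.
Qed.

(** * Polynomially bounded functions *)

(** The base [n + 2] is at least 2, so constants, sums and products are absorbed by a larger
    exponent. *)
Definition pb (b : nat -> nat) := exists k, forall n, b n <= (n + 2) ^ k.

Lemma pb_le b1 b2 : (forall n, b1 n <= b2 n) -> pb b2 -> pb b1.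
Proof. by move=> le [k bk]; exists k => n; apply: leq_trans (le n) (bk n). Qed.

Lemma pb_pow k : pb (fun n => (n + 2) ^ k).
Proof. by exists k. Qed.

Lemma pb_const c : pb (fun=> c).
Proof.
exists c => n; apply: leq_trans (ltnW (ltn_expl c (ltnSn 1))) _.
by case: c => // c; rewrite leq_exp2r //; lia.
Qed.

Lemma pb_id : pb id.
Proof. by exists 1 => n; rewrite expn1; lia. Qed.

Lemma pb_mul b1 b2 : pb b1 -> pb b2 -> pb (fun n => b1 n * b2 n).
Proof.
by move=> [k1 h1] [k2 h2]; exists (k1 + k2) => n; rewrite expnD leq_mul.
Qed.

Lemma pb_add b1 b2 : pb b1 -> pb b2 -> pb (fun n => b1 n + b2 n).
Proof.
move=> [k1 h1] [k2 h2]; exists (k1 + k2).+1 => n; rewrite expnS expnD.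
have p1 : 0 < (n + 2) ^ k1 by rewrite expn_gt0; lia.
have p2 : 0 < (n + 2) ^ k2 by rewrite expn_gt0; lia.
by have := h1 n; have := h2 n; nia.
Qed.

Lemma pb_comp k b : pb b -> pb (fun n => (b n + 2) ^ k).
Proof.
move=> [l hl]; exists (l.+2 * k) => n; rewrite expnM.
case: k => [|k]; rewrite ?expn0 // leq_exp2r // !expnS.
have p1 : 0 < (n + 2) ^ l by rewrite expn_gt0; lia.
by have := hl n; nia.
Qed.

Ltac pb := repeat first [exact: pb_const | exact: pb_id | exact: pb_pow
  | apply: pb_add | apply: pb_mul | apply: pb_comp].

(** * Polynomial-time functions on trees *)

(** Quantifying over the pending commands and the past outputs makes runs compose; it also forces
    the command to emit nothing. *)
Definition exec c s t s' :=
  forall cs o, iter t step (Config (c :: cs) s o) = Config cs s' o.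

Lemma exec_assign i e s : exec (Assign i e) s 1 (upd s i (eval s e)).
Proof. by []. Qed.

Lemma exec_seq c1 c2 s t1 s1 t2 s2 :
  exec c1 s t1 s1 -> exec c2 s1 t2 s2 -> exec (Seq c1 c2) s (t1 + t2).+1 s2.
Proof.
by move=> e1 e2 cs o; rewrite iterSr addnC iterD /= e1 e2.
Qed.

Lemma exec_if e c1 c2 s t s' :
  exec (if isnode (eval s e) then c1 else c2) s t s' ->
  exec (If e c1 c2) s t.+1 s'.
Proof. by move=> h cs o; rewrite iterSr /= -h; case: (eval s e). Qed.

Lemma exec_while_leaf e c s : isnode (eval s e) = false -> exec (While e c) s 1 s.
Proof. by move=> h cs o /=; case: (eval s e) h. Qed.

Lemma exec_while_node e c s t1 s1 t2 s2 : isnode (eval s e) ->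
  exec c s t1 s1 -> exec (While e c) s1 t2 s2 ->
  exec (While e c) s (t1 + t2).+1 s2.
Proof.
move=> h e1 e2 cs o; rewrite iterSr addnC iterD /=.
by case: (eval s e) h => // l r _; rewrite e1 e2.
Qed.

(** Variable 0 carries the argument and the result. Variables from [N] on are left intact, so
    surrounding code can store its own data there. *)
Definition computes c N f b := forall s, exists t s',
  [/\ exec c s t s', t <= b (tsize (s 0)), s' 0 = f (s 0)
    & forall j, N <= j -> s' j = s j].

(** The size bound is what permits composition: the time of an outer program is measured on the
    output of the inner one. *)
Definition FP f := exists c N k,
  [/\ 0 < N, computes c N f (fun n => (n + 2) ^ k)
    & forall x, tsize (f x) <= (tsize x + 2) ^ k].

Lemma FP_intro c N f b1 b2 : 0 < N -> pb b1 -> pb b2 ->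
  computes c N f b1 -> (forall x, tsize (f x) <= b2 (tsize x)) -> FP f.
Proof.
move=> N0 p1 p2 h1 h2; have [k hk] := pb_add p1 p2.
exists c, N, k; split=> // [s|x]; last by apply: leq_trans (h2 x) _; have := hk (tsize x); lia.
have [t [s' [e le ? ?]]] := h1 s; exists t, s'; split=> //.
by apply: leq_trans le _; have := hk (tsize (s 0)); lia.
Qed.

Lemma FP_ext f g : f =1 g -> FP f -> FP g.
Proof.
move=> fg [c [N [k [N0 h1 h2]]]]; exists c, N, k; split=> // [s|x]; rewrite -?fg //.
Qed.

Lemma FP_size_bound f : FP f -> exists k, forall x, tsize (f x) <= (tsize x + 2) ^ k.
Proof. by move=> [c [N [k []]]]; exists k. Qed.

Lemma pow_mono a b k : a <= b -> (a + 2) ^ k <= (b + 2) ^ k.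
Proof. by move=> ab; case: k => // k; rewrite leq_exp2r //; lia. Qed.

Lemma upd_same s i v : upd s i v i = v.
Proof. by rewrite /upd eqxx. Qed.

Lemma upd_other s i v j : j != i -> upd s i v j = s j.
Proof. by rewrite /upd => /negPf ->. Qed.

Lemma FP_expr f e : (forall s, eval s e = f (s 0)) ->
  (exists2 b, pb b & forall x, tsize (f x) <= b (tsize x)) -> FP f.
Proof.
move=> ev [b pbb hb].
apply: (@FP_intro (Assign 0 e) 1 f (fun=> 1) b) => //; first exact: pb_const.
move=> s; exists 1, (upd s 0 (eval s e)); split=> //.
  by rewrite upd_same ev.
by move=> j j0; rewrite upd_other //; lia.
Qed.

Lemma FP_id : FP id.
Proof. by apply: (@FP_expr _ (EVar 0)) => //; exists id => //; apply: pb_id. Qed.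

Lemma FP_Leaf : FP (fun=> Leaf).
Proof. by apply: (@FP_expr _ ELeaf) => //; exists (fun=> 1) => //; apply: pb_const. Qed.

Lemma FP_comp f g : FP f -> FP g -> FP (fun x => f (g x)).
Proof.
move=> [c1 [N1 [k1 [N10 h1 z1]]]] [c2 [N2 [k2 [N20 h2 z2]]]].
apply: (@FP_intro (Seq c2 c1) (maxn N1 N2) _
  (fun n => (n + 2) ^ k2 + ((n + 2) ^ k2 + 2) ^ k1 + 1)
  (fun n => ((n + 2) ^ k2 + 2) ^ k1)); try by pb.
- by lia.
- move=> s; have [t2 [s2 [e2 le2 v2 f2]]] := h2 s.
  have [t1 [s1 [e1 le1 v1 f1]]] := h1 s2.
  exists (t2 + t1).+1, s1; split; first exact: exec_seq e2 e1.
  + by rewrite v2 in le1; have := pow_mono k1 (z2 (s 0)); lia.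
  + by rewrite v1 v2.
  by move=> j jN; rewrite f1 ?f2 //; lia.
by move=> x; apply: leq_trans (z1 _) (pow_mono _ (z2 _)).
Qed.

Lemma FP_left f : FP f -> FP (fun x => tleft (f x)).
Proof.
apply: FP_comp; apply: (@FP_expr _ (ELeft (EVar 0))) => //.
by exists id; [apply: pb_id|apply: tsize_left].
Qed.

Lemma FP_right f : FP f -> FP (fun x => tright (f x)).
Proof.
apply: FP_comp; apply: (@FP_expr _ (ERight (EVar 0))) => //.
by exists id; [apply: pb_id|apply: tsize_right].
Qed.

Ltac vars := repeat (rewrite upd_same || (rewrite upd_other; last by lia)).


Lemma FP_node f g : FP f -> FP g -> FP (fun x => Node (f x) (g x)).
Proof.
move=> [c1 [N1 [k1 [N10 h1 z1]]]] [c2 [N2 [k2 [N20 h2 z2]]]].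
(* [V] keeps the argument and [V.+1] the first result, both out of reach of [c1] and [c2]. *)
pose V := maxn N1 N2.
apply: (@FP_intro (Seq (Assign V (EVar 0)) (Seq c1 (Seq (Assign V.+1 (EVar 0))
  (Seq (Assign 0 (EVar V)) (Seq c2 (Assign 0 (ENode (EVar V.+1) (EVar 0))))))))
  V.+2 _ (fun n => (n + 2) ^ k1 + (n + 2) ^ k2 + 9)
  (fun n => (n + 2) ^ k1 + (n + 2) ^ k2 + 1)); try by pb.
- move=> s; pose s0 := upd s V (s 0).
  have [t1 [s1 [e1 le1 v1 f1]]] := h1 s0.
  pose s2 := upd (upd s1 V.+1 (s1 0)) 0 (upd s1 V.+1 (s1 0) V).
  have [t2 [s3 [e2 le2 v2 f2]]] := h2 s2.
  have E0 : s0 0 = s 0 by rewrite /s0; vars.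
  have E2 : s2 0 = s 0 by rewrite /s2; vars; rewrite f1 ?leq_maxl // /s0; vars.
  do 2 eexists; split.
  + apply: exec_seq; first exact: exec_assign.
    apply: exec_seq; first exact: e1.
    apply: exec_seq; first exact: exec_assign.
    apply: exec_seq; first exact: exec_assign.
    apply: exec_seq; first exact: e2.
    exact: exec_assign.
  + by rewrite E0 in le1; rewrite E2 in le2; lia.
  + rewrite upd_same /= v2 E2 f2 /s2; last by rewrite /V; lia.
    by vars; rewrite v1 E0.
  move=> j jV; vars; rewrite f2 /s2 /V; last by lia.
  by vars; rewrite f1; [rewrite /s0; vars|lia].
by move=> x /=; have := z1 x; have := z2 x; lia.
Qed.

Lemma FP_if_node h f g : FP h -> FP f -> FP g ->
  FP (fun x => if isnode (h x) then f x else g x).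
Proof.
move=> [c0 [N0 [k0 [N00 h0 z0]]]] [c1 [N1 [k1 [N10 h1 z1]]]] [c2 [N2 [k2 [N20 h2 z2]]]].
pose V := maxn N0 (maxn N1 N2).
apply: (@FP_intro (Seq (Assign V (EVar 0)) (Seq c0 (Seq (Assign V.+1 (EVar 0))
  (Seq (Assign 0 (EVar V)) (If (EVar V.+1) c1 c2)))))
  V.+2 _ (fun n => (n + 2) ^ k0 + ((n + 2) ^ k1 + (n + 2) ^ k2) + 9)
  (fun n => (n + 2) ^ k1 + (n + 2) ^ k2)); try by pb.
- move=> s; pose s0 := upd s V (s 0).
  have [t1 [s1 [e1 le1 v1 f1]]] := h0 s0.
  pose s2 := upd (upd s1 V.+1 (s1 0)) 0 (upd s1 V.+1 (s1 0) V).
  have E0 : s0 0 = s 0 by rewrite /s0; vars.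
  have E2 : s2 0 = s 0 by rewrite /s2; vars; rewrite f1 ?leq_maxl // /s0; vars.
  have EV : s2 V.+1 = h (s 0) by rewrite /s2; vars; rewrite v1 E0.
  have [t2 [s3 [e2 le2 v2 f2]]] : exists t s', [/\
      exec (if isnode (h (s 0)) then c1 else c2) s2 t s',
      t <= (tsize (s 0) + 2) ^ k1 + (tsize (s 0) + 2) ^ k2,
      s' 0 = (if isnode (h (s 0)) then f (s 0) else g (s 0))
      & forall j, V <= j -> s' j = s2 j].
    case: ifP => _.
      have [t [s' [e le v fr]]] := h1 s2; exists t, s'; rewrite -E2; split=> //; first by lia.
      by move=> j jV; apply: fr; rewrite /V in jV; lia.
    have [t [s' [e le v fr]]] := h2 s2; exists t, s'; rewrite -E2; split=> //; first by lia.
    by move=> j jV; apply: fr; rewrite /V in jV; lia.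
  do 2 eexists; split.
  + apply: exec_seq; first exact: exec_assign.
    apply: exec_seq; first exact: e1.
    apply: exec_seq; first exact: exec_assign.
    apply: exec_seq; first exact: exec_assign.
    by apply: exec_if; rewrite /= -/s2 EV; exact: e2.
  + by rewrite E0 in le1; lia.
  + by rewrite v2.
  move=> j jV; rewrite f2 /s2; last by lia.
  by vars; rewrite f1; [rewrite /s0; vars|rewrite /V in jV; lia].
by move=> x /=; have := z1 x; have := z2 x; case: ifP; lia.
Qed.

Section Fold.
Variables (g : tree -> tree -> tree -> tree) (c : cmd) (N k : nat).
Hypothesis N0 : 0 < N.
Hypothesis hc : computes c N
  (fun z => g (tleft (tleft z)) (tright (tleft z)) (tright z))
  (fun n => (n + 2) ^ k).

Let body := Seq (Assign 0 (ENode (ENode (EVar N) (EVar N.+2)) (ELeft (EVar N.+1))))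
  (Seq c (Seq (Assign N.+2 (EVar 0)) (Assign N.+1 (ERight (EVar N.+1))))).

(** [N] holds the parameter, [N.+1] the remaining list, [N.+2] the accumulator. A single [B] bounds
    the argument of [c] in every iteration; assuming it for all prefixes lets the induction move
    down the list. *)
Lemma fold_loop l x B s : s N = x -> s N.+1 = l ->
  (forall i, tsize x + tsize (foldl (g x) (s N.+2) (take i (tseq l))) + tsize l + 2 <= B) ->
  exists t s', [/\ exec (While (EVar N.+1) body) s t s',
    t <= size (tseq l) * ((B + 2) ^ k + 8) + 1,
    s' N.+2 = foldl (g x) (s N.+2) (tseq l)
    & forall j, N.+3 <= j -> s' j = s j].
Proof.
elim: l s => [|a _ l IH] s sN sL hB.
  by exists 1, s; split=> //; apply: exec_while_leaf; rewrite /= sL.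
pose s0 := upd s 0 (Node (Node (s N) (s N.+2)) a).
have [t1 [s1 [e1 le1 v1 f1]]] := hc s0.
have f1' j : 0 < j -> N <= j -> s1 j = s j.
  by move=> j0 jN; rewrite f1 // /s0; vars.
pose s2 := upd (upd s1 N.+2 (s1 0)) N.+1 l.
have E2 : s2 N.+2 = g x (s N.+2) a.
  by rewrite /s2; vars; rewrite v1 /s0 upd_same /= sN.
have [||i|t2 [s3 [e3 le3 v3 f3]]] := IH s2.
- by rewrite /s2; vars; rewrite f1' ?sN //; lia.
- by rewrite /s2; vars.
- by rewrite E2; have := hB i.+1; rewrite /=; have := tsize_gt0 a; lia.
exists ((1 + (t1 + (1 + 1).+1).+1).+1 + t2).+1, s3; split.
- apply: (exec_while_node (s1 := s2)) => //; first by rewrite /= sL.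
  apply: (exec_seq (s1 := s0)).
    by have := exec_assign 0 (ENode (ENode (EVar N) (EVar N.+2)) (ELeft (EVar N.+1))) s; rewrite /= sL.
  apply: exec_seq; first exact: e1.
  apply: exec_seq; first exact: exec_assign.
  have Ev : eval (upd s1 N.+2 (s1 0)) (ERight (EVar N.+1)) = l.
    by rewrite /= upd_other ?f1' ?sL //; lia.
  by rewrite /s2 -Ev.
- have t1B : t1 <= (B + 2) ^ k.
    apply: leq_trans le1 _; rewrite /s0 upd_same /= sN; apply: pow_mono.
    by have := hB 0; rewrite /=; lia.
  by move: le3; rewrite /= mulSn; lia.
- by rewrite v3 E2.
by move=> j jN; rewrite f3 // /s2; vars; rewrite f1' //; lia.
Qed.
End Fold.

Lemma FP_fold_bound l init g : FP l -> FP init ->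
  FP (fun z => g (tleft (tleft z)) (tright (tleft z)) (tright z)) ->
  (exists2 b, pb b & forall x i,
     tsize (foldl (g x) (init x) (take i (tseq (l x)))) <= b (tsize x)) ->
  FP (fun x => foldl (g x) (init x) (tseq (l x))).
Proof.
move=> [c1 [N1 [k1 [N10 h1 z1]]]] [c2 [N2 [k2 [N20 h2 z2]]]].
move=> [c3 [N3 [k3 [N30 h3 z3]]]] [b pbb hb].
pose V := maxn N1 (maxn N2 N3).
have h3' : computes c3 V (fun z => g (tleft (tleft z)) (tright (tleft z)) (tright z))
    (fun n => (n + 2) ^ k3).
  move=> s; have [t [s' [? ? ? fr]]] := h3 s; exists t, s'; split=> // j jV.
  by apply: fr; rewrite /V in jV; lia.
have V0 : 0 < V by rewrite /V; lia.
pose body := Seq (Assign 0 (ENode (ENode (EVar V) (EVar V.+2)) (ELeft (EVar V.+1))))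
  (Seq c3 (Seq (Assign V.+2 (EVar 0)) (Assign V.+1 (ERight (EVar V.+1))))).
pose BB n := n + b n + (n + 2) ^ k1 + 2.
apply: (@FP_intro (Seq (Assign V (EVar 0)) (Seq c1 (Seq (Assign V.+1 (EVar 0))
  (Seq (Assign 0 (EVar V)) (Seq c2 (Seq (Assign V.+2 (EVar 0))
  (Seq (While (EVar V.+1) body) (Assign 0 (EVar V.+2)))))))))
  V.+3 _ (fun n => (n + 2) ^ k1 + (n + 2) ^ k2 + (n + 2) ^ k1 * ((BB n + 2) ^ k3 + 8) + 20)
  b) => //; first by rewrite /BB; pb.
- move=> s; pose s0 := upd s V (s 0).
  have [t1 [s1 [e1 le1 v1 f1]]] := h1 s0.
  pose s2 := upd (upd s1 V.+1 (s1 0)) 0 (upd s1 V.+1 (s1 0) V).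
  have E0 : s0 0 = s 0 by rewrite /s0; vars.
  have E2 : s2 0 = s 0.
    by rewrite /s2; vars; rewrite f1 /s0 ?upd_same // /V; lia.
  have EL : s2 V.+1 = l (s 0) by rewrite /s2; vars; rewrite v1 E0.
  have [t2 [s3 [e2 le2 v2 f2]]] := h2 s2.
  pose s4 := upd s3 V.+2 (s3 0).
  have f2' j : V <= j -> s3 j = s2 j by move=> jV; rewrite f2 //; rewrite /V in jV; lia.
  have f1' j : V <= j -> s1 j = s0 j by move=> jV; rewrite f1 //; rewrite /V in jV; lia.
  have E4 : s4 V = s 0.
    by rewrite /s4; vars; rewrite f2' // /s2; vars; rewrite f1' // /s0; vars.
  have E4l : s4 V.+1 = l (s 0) by rewrite /s4; vars; rewrite f2'.
  have E4a : s4 V.+2 = init (s 0) by rewrite /s4; vars; rewrite v2 E2.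
  have [i|t5 [s5 [e5 le5 v5 f5]]] := fold_loop V0 h3' (B := BB (tsize (s 0))) E4 E4l.
    by rewrite E4a /BB; have := hb (s 0) i; have := z1 (s 0); lia.
  do 2 eexists; split.
  + apply: exec_seq; first exact: exec_assign.
    apply: exec_seq; first exact: e1.
    apply: exec_seq; first exact: exec_assign.
    apply: exec_seq; first exact: exec_assign.
    apply: exec_seq; first exact: e2.
    apply: exec_seq; first exact: exec_assign.
    apply: exec_seq; first exact: e5.
    exact: exec_assign.
  + rewrite E0 in le1; rewrite E2 in le2.
    have := leq_mul (leqnn ((BB (tsize (s 0)) + 2) ^ k3 + 8))
      (ltnW (leq_trans (size_tseq (l (s 0))) (z1 (s 0)))).
    by rewrite ![((BB _ + 2) ^ _ + 8) * _]mulnC; lia.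
  + by rewrite upd_same /= v5 E4a.
  move=> j jV; vars; rewrite f5 // /s4; vars; rewrite f2' /s2; last by lia.
  by vars; rewrite f1' /s0; [vars|lia].
by move=> x; have := hb x (size (tseq (l x))); rewrite take_size.
Qed.

(* Depth-first traversal with an explicit stack. *)
Lemma FP_tsize : FP (fun x => enc_nat (tsize x)).
Proof.
pose body := Seq (Assign 2 (ENode ELeaf (EVar 2)))
  (If (ELeft (EVar 1))
     (Assign 1 (ENode (ELeft (ELeft (EVar 1)))
                 (ENode (ERight (ELeft (EVar 1))) (ERight (EVar 1)))))
     (Assign 1 (ERight (EVar 1)))).
have loop n st s : \sum_(e <- st) tsize e <= n -> s 1 = tlist st ->
    exists t s', [/\ exec (While (EVar 1) body) s t s',
      t <= (\sum_(e <- st) tsize e) * 5 + 1,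
      s' 2 = iter (\sum_(e <- st) tsize e) (Node Leaf) (s 2)
      & forall j, 3 <= j -> s' j = s j].
  elim: n st s => [|n IH] [|a st] s; rewrite ?big_nil ?big_cons.
  - by move=> _ s1; exists 1, s; split=> //; apply: exec_while_leaf; rewrite /= s1.
  - by have := tsize_gt0 a; lia.
  - by move=> _ s1; exists 1, s; split=> //; apply: exec_while_leaf; rewrite /= s1.
  move=> le s1.
  pose st' := if a is Node l r then [:: l, r & st] else st.
  have Est : tsize a + \sum_(e <- st) tsize e = (\sum_(e <- st') tsize e).+1.
    by rewrite /st'; case: a {le s1 st'} => [|l r]; rewrite ?big_cons /=; lia.
  pose s0 := upd (upd s 2 (Node Leaf (s 2))) 1 (tlist st').
  have e0 : exec body s (1 + 2).+1 s0.
    rewrite /body; apply: exec_seq; first exact: exec_assign.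
    apply: exec_if; rewrite /= upd_other // s1 /= /s0 /st'.
    case: a s1 {le st' Est s0} => [|l r] s1 /=.
      have := exec_assign 1 (ERight (EVar 1)) (upd s 2 (Node Leaf (s 2))).
      by rewrite /= upd_other // s1.
    have := exec_assign 1 (ENode (ELeft (ELeft (EVar 1)))
      (ENode (ERight (ELeft (EVar 1))) (ERight (EVar 1)))) (upd s 2 (Node Leaf (s 2))).
    by rewrite /= upd_other // s1.
  have [||t [s' [e le' v f]]] := IH st' s0; [lia|by rewrite /s0; vars|].
  exists (4 + t).+1, s'; split.
  + by apply: exec_while_node e0 e; rewrite /= s1.
  + by rewrite Est; lia.
  + by rewrite v Est /s0 iterSr; vars.
  by move=> j j3; rewrite f // /s0; vars.
apply: (@FP_intro (Seq (Assign 1 (ENode (EVar 0) ELeaf)) (Seq (Assign 2 ELeaf)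
   (Seq (While (EVar 1) body) (Assign 0 (EVar 2))))) 3 _
   (fun n => n * 5 + 10) (fun n => n * 2 + 1)); try by pb.
- move=> s; pose s0 := upd (upd s 1 (Node (s 0) Leaf)) 2 Leaf.
  have [||t [s' [e le v f]]] := loop (tsize (s 0)) [:: s 0] s0.
  + by rewrite big_seq1.
  + by rewrite /s0; vars.
  rewrite big_seq1 in le v; do 2 eexists; split.
  + apply: exec_seq; first exact: exec_assign.
    apply: exec_seq; first exact: exec_assign.
    by apply: exec_seq; [exact: e|exact: exec_assign].
  + by lia.
  + by rewrite upd_same /= v /s0 upd_same.
  by move=> j j3; vars; rewrite f // /s0; vars.
by move=> x; rewrite tsize_enc_nat; lia.
Qed.

(** * Clocked execution of a program *)

Section Clock.
Variable V : nat.

(* Variable [V] holds the remaining number of steps in unary, [V.+1] the list of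
   the outputs (last one first), [V.+2] a loop guard, and [V.+3 + i] the
   contents of variable [i] of the simulated program. *)
Fixpoint eshift (e : expr) : expr :=
  match e with
  | EVar i => EVar (V.+3 + i)
  | ELeaf => ELeaf
  | ENode e1 e2 => ENode (eshift e1) (eshift e2)
  | ELeft e1 => ELeft (eshift e1)
  | ERight e1 => ERight (eshift e1)
  end.

(** On an exhausted clock [c] is skipped and the loop guard cleared, so that enclosing loops end. *)
Definition tick c :=
  If (EVar V) (Seq (Assign V (ERight (EVar V))) c) (Assign V.+2 ELeaf).

Definition guard e := tick (Assign V.+2 (eshift e)).

(** A loop tests [V.+2] instead of its own condition, so that running out of time also ends it. Each
    evaluation of the condition costs one tick, like a step of [While] in the source. *)
Fixpoint clocked (c : cmd) : cmd :=
  match c with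
  | Assign i e => tick (Assign (V.+3 + i) (eshift e))
  | Emit e => tick (Assign V.+1 (ENode (eshift e) (EVar V.+1)))
  | Seq c1 c2 => tick (Seq (clocked c1) (clocked c2))
  | If e c1 c2 => tick (If (eshift e) (clocked c1) (clocked c2))
  | While e c1 =>
      Seq (guard e) (While (EVar V.+2) (Seq (clocked c1) (guard e)))
  end.

(** [StackW] is a loop already entered: once the commands above it are done, its guard is
    recomputed. The commands in [rest] follow the simulation. *)
Inductive clocked_stack (rest : seq cmd) : seq cmd -> seq cmd -> Prop :=
  | Stack0 : clocked_stack rest [::] rest
  | StackS c cs qs : clocked_stack rest cs qs ->
      clocked_stack rest (c :: cs) (clocked c :: qs)
  | StackW e c cs qs : clocked_stack rest cs qs ->
      clocked_stack rest (While e c :: cs)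
        [:: guard e, While (EVar V.+2) (Seq (clocked c) (guard e)) & qs].

Definition simulates (q : store) m s o :=
  [/\ q V = enc_nat m, q V.+1 = tlist (rev o) & forall i, q (V.+3 + i) = s i].

Lemma eval_eshift q s e :
  (forall i, q (V.+3 + i) = s i) -> eval q (eshift e) = eval s e.
Proof. by move=> h; elim: e => //= [e1 -> e2 ->|e1 ->|e1 ->]. Qed.

(** A pending command costs at most 4 steps, the worst case being a loop not yet entered: unfolding,
    the failing tick, its assignment and the loop test. *)
Lemma out_of_time q rest cs qs oq : clocked_stack rest cs qs -> q V = Leaf ->
  exists t q', [/\ t <= 4 * size cs,
    iter t step (Config qs q oq) = Config rest q' oq,
    q' V.+1 = q V.+1 & forall j, j < V -> q' j = q j].
Proof.
move=> st; elim: st q => {cs qs} [|c cs qs _ IH|e c cs qs _ IH] q qV.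
- by exists 0, q.
- pose q1 := upd q V.+2 Leaf.
  have q1V : q1 V = Leaf by rewrite /q1; vars.
  have q1G : q1 V.+2 = Leaf by rewrite /q1; vars.
  have [t [q' [le it o' f]]] := IH _ q1V.
  have fr j : j < V -> q' j = q j by move=> jV; rewrite f // /q1; vars.
  have o1 : q' V.+1 = q V.+1 by rewrite o' /q1; vars.
  case: c => [i e|e|c1 c2|e c1 c2|e c1];
    [exists (t + 2), q'|exists (t + 2), q'|exists (t + 2), q'
    |exists (t + 2), q'|exists (t + 4), q'];
    (split=> //; first by rewrite /=; lia);
    by rewrite iterD /= qV /= -/q1 ?q1G it.
pose q1 := upd q V.+2 Leaf.
have q1V : q1 V = Leaf by rewrite /q1; vars.
have q1G : q1 V.+2 = Leaf by rewrite /q1; vars.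
have [t [q' [le it o' f]]] := IH _ q1V.
exists (t + 3), q'; split; first by rewrite /=; lia.
- by rewrite iterD /= qV /= -/q1 q1G it.
- by rewrite o' /q1; vars.
by move=> j jV; rewrite f // /q1; vars.
Qed.

(** A source step takes at most 7 steps here and adds at most one pending command, worth 4 more when
    time runs out; 7 + 4 is within 12. *)
Lemma clocked_run m rest cs qs q s o oq : clocked_stack rest cs qs ->
  simulates q m s o ->
  exists t q', [/\ t <= 12 * m + 4 * size cs,
    iter t step (Config qs q oq) = Config rest q' oq,
    q' V.+1 = tlist (rev (out (iter m step (Config cs s o))))
    & forall j, j < V -> q' j = q j].
Proof.
elim: m cs qs q s o => [|m IH] cs qs q s o st [qV qO qs'].
  have [t [q' [le it o' f]]] := out_of_time oq st qV.
  by exists t, q'; split=> //; rewrite o' qO.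
have {}qV : q V = Node Leaf (enc_nat m) by [].
pose q0 := upd q V (enc_nat m).
have ev e : eval q0 (eshift e) = eval s e.
  by apply: eval_eshift => i; rewrite /q0; vars.
have q0V : q0 V = enc_nat m by rewrite /q0; vars.
have q0O : q0 V.+1 = tlist (rev o) by rewrite /q0; vars.
have q0s i : q0 (V.+3 + i) = s i by rewrite /q0; vars.
have q0f j : j < V -> q0 j = q j by move=> jV; rewrite /q0; vars.
have continue k q1 cs1 qs1 s1 o1 :
    iter k step (Config qs q oq) = Config qs1 q1 oq ->
    step (Config cs s o) = Config cs1 s1 o1 ->
    clocked_stack rest cs1 qs1 -> k <= 7 -> size cs1 <= (size cs).+1 ->
    simulates q1 m s1 o1 -> (forall j, j < V -> q1 j = q j) ->
    exists t q', [/\ t <= 12 * m.+1 + 4 * size cs,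
      iter t step (Config qs q oq) = Config rest q' oq,
      q' V.+1 = tlist (rev (out (iter m.+1 step (Config cs s o))))
      & forall j, j < V -> q' j = q j].
  move=> it stp st1 k7 sz sim1 f1.
  have [t [q' [le it' o' f']]] := IH _ _ _ _ _ st1 sim1.
  exists (t + k), q'; split; first by lia.
  - by rewrite iterD it it'.
  - by rewrite iterSr stp.
  by move=> j jV; rewrite f' // f1.
(* Covers a loop still folded, with one step ([k = 1]) to expose its guard, and a loop already
   entered ([k = 0]). *)
have loop e c cs1 qs1 k : clocked_stack rest cs1 qs1 -> cs = While e c :: cs1 -> k <= 1 ->
    iter k step (Config qs q oq) =
      Config [:: guard e, While (EVar V.+2) (Seq (clocked c) (guard e)) & qs1] q oq ->
    exists t q', [/\ t <= 12 * m.+1 + 4 * size cs,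
      iter t step (Config qs q oq) = Config rest q' oq,
      q' V.+1 = tlist (rev (out (iter m.+1 step (Config cs s o))))
      & forall j, j < V -> q' j = q j].
  move=> st1 Ecs k1 it1; pose q1 := upd q0 V.+2 (eval s e).
  have q1G : q1 V.+2 = eval s e by rewrite /q1; vars.
  have sim1 : simulates q1 m s o.
    by split=> [||i]; rewrite /q1; vars.
  have q1f j : j < V -> q1 j = q j by move=> jV; rewrite /q1; vars; apply: q0f.
  case E: (eval s e) => [|l r].
    apply: (@continue (5 + k) q1 cs1 qs1 s o) => //; try lia.
    - by rewrite iterD it1 /= qV /= ?qV /= -/q0 ev -/q1 q1G E.
    - by rewrite Ecs /= E.
    - by rewrite Ecs /=; lia.
  apply: (@continue (6 + k) q1 [:: c, While e c & cs1]
    [:: clocked c, guard e, While (EVar V.+2) (Seq (clocked c) (guard e)) & qs1] s o) => //; try lia.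
  - by rewrite iterD it1 /= qV /= ?qV /= -/q0 ev -/q1 q1G E.
  - by rewrite Ecs /= E.
  - by constructor; constructor.
  by rewrite Ecs /=; lia.
case: st continue loop => [|c cs1 qs1 st|e c cs1 qs1 st] continue loop.
- exists 0, q; split=> //; rewrite qO.
  by have -> : iter m.+1 step (Config [::] s o) = Config [::] s o by elim: (m.+1) => //= n ->.
- case: c continue loop => [i e|e|c1 c2|e c1 c2|e c1] continue loop.
  + apply: (@continue 4 (upd q0 (V.+3 + i) (eval s e)) cs1 qs1 (upd s i (eval s e)) o) => //.
    * by rewrite /= qV /= ?qV /= -/q0 ev.
    * by rewrite /=; lia.
    * split=> [||j]; [by vars|by vars|].
      by rewrite /upd eqn_add2l; case: eqP => // _; apply: q0s.
    by move=> j jV; vars; apply: q0f.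
  + apply: (@continue 4 (upd q0 V.+1 (Node (eval s e) (tlist (rev o)))) cs1 qs1 s
      (rcons o (eval s e))) => //.
    * by rewrite /= qV /= ?qV /= -/q0 ev q0O.
    * by rewrite /=; lia.
    * by split=> [||j]; vars => //; rewrite rev_rcons.
    by move=> j jV; vars; apply: q0f.
  + apply: (@continue 4 q0 [:: c1, c2 & cs1] [:: clocked c1, clocked c2 & qs1] s o) => //.
    * by rewrite /= qV /= qV.
    * by constructor; constructor.
  + apply: (@continue 4 q0 ((if eval s e is Leaf then c2 else c1) :: cs1)
      (clocked (if eval s e is Leaf then c2 else c1) :: qs1) s o) => //.
    * by rewrite /= qV /= ?qV /= -/q0 ev; case: (eval s e).
    * by constructor.
  + exact: (loop e c1 cs1 qs1 1).
exact: (loop e c cs1 qs1 0).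
Qed.

End Clock.

(** * Closure properties of polynomial-time functions *)

Lemma all_take (U : Type) (p : pred U) s i : all p s -> all p (take i s).
Proof. by elim: s i => //= a s IH [|i] //= /andP[-> /IH ->]. Qed.

Lemma tseq_small t : all (fun e => tsize e <= tsize t) (tseq t).
Proof.
elim: t => //= a _ u IH; apply/andP; split; first by lia.
by apply: sub_all IH => e /=; lia.
Qed.

Lemma foldl_bound (g : tree -> tree -> tree) q B s acc :
  all (fun e => tsize e <= B) s ->
  (forall acc e, tsize e <= B -> tsize (g acc e) <= tsize acc + q) ->
  tsize (foldl g acc s) <= tsize acc + size s * q.
Proof.
move=> + hg; elim: s acc => [|e s IH] acc /=; first by lia.
by case/andP => /(hg acc) he /(IH (g acc e)); rewrite mulSn; lia.
Qed.

Lemma FP_app2 h f g : FP (fun z => h (tleft z) (tright z)) -> FP f -> FP g ->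
  FP (fun x => h (f x) (g x)).
Proof. by move=> Fh Ff Fg; apply: (FP_comp Fh (FP_node Ff Fg)). Qed.

(** Additive growth, depending on the argument alone, keeps the accumulators polynomial;
    multiplicative growth at each step would not. *)
Lemma FP_fold l init g : FP l -> FP init ->
  FP (fun z => g (tleft (tleft z)) (tright (tleft z)) (tright z)) ->
  (exists2 b, pb b & forall x acc e, tsize e <= tsize (l x) ->
     tsize (g x acc e) <= tsize acc + b (tsize x)) ->
  FP (fun x => foldl (g x) (init x) (tseq (l x))).
Proof.
move=> Fl Fi Fg [b pbb hb]; apply: FP_fold_bound => //.
have [k1 z1] := FP_size_bound Fl; have [k2 z2] := FP_size_bound Fi.
exists (fun n => (n + 2) ^ k2 + (n + 2) ^ k1 * b n); first by pb.
move=> x i; apply: leq_trans (foldl_bound _ _ (hb x)) _.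
  exact: all_take (tseq_small _).
apply: leq_add => //; apply: leq_mul => //.
apply: leq_trans (z1 x).
by rewrite size_take_min; have := size_tseq (l x); lia.
Qed.

Definition FPB (b : tree -> bool) := FP (fun x => enc_bool (b x)).

Lemma FP_if b f g : FPB b -> FP f -> FP g -> FP (fun x => if b x then f x else g x).
Proof.
move=> Fb Ff Fg; apply: FP_ext (FP_if_node Fb Ff Fg) => x.
by case: (b x).
Qed.

Lemma FPB_app2 p f g : FPB (fun z => p (tleft z) (tright z)) -> FP f -> FP g ->
  FPB (fun x => p (f x) (g x)).
Proof. exact: (@FP_app2 (fun x y => enc_bool (p x y))). Qed.

Lemma FPB_true : FPB (fun=> true).
Proof. exact: FP_node FP_Leaf FP_Leaf. Qed.

Lemma FPB_isnode f : FP f -> FPB (fun x => isnode (f x)).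
Proof.
move=> Ff; apply: FP_ext (FP_if_node Ff (FP_node FP_Leaf FP_Leaf) FP_Leaf) => x.
by case: (f x).
Qed.

Lemma FPB_neg b : FPB b -> FPB (fun x => ~~ b x).
Proof.
move=> Fb; apply: FP_ext (FP_if Fb FP_Leaf FPB_true) => x.
by case: (b x).
Qed.

Lemma FPB_and b1 b2 : FPB b1 -> FPB b2 -> FPB (fun x => b1 x && b2 x).
Proof.
move=> F1 F2; apply: FP_ext (FP_if F1 F2 FP_Leaf) => x.
by case: (b1 x).
Qed.

Lemma FPB_or b1 b2 : FPB b1 -> FPB b2 -> FPB (fun x => b1 x || b2 x).
Proof.
move=> F1 F2; apply: FP_ext (FP_if F1 FPB_true F2) => x.
by case: (b1 x).
Qed.

Lemma FPB_imp b1 b2 : FPB b1 -> FPB b2 -> FPB (fun x => b1 x ==> b2 x).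
Proof.
move=> F1 F2; apply: FP_ext (FP_if F1 F2 FPB_true) => x.
by case: (b1 x).
Qed.

Lemma foldl_push (h : tree -> tree) a s :
  foldl (fun a e => Node (h e) a) a s = tlist (rev (map h s) ++ tseq a).
Proof.
elim: s a => [|e s IH] a /=; first by rewrite tseqK.
by rewrite IH rev_cons cat_rcons.
Qed.

Lemma FP_rev f : FP f -> FP (fun x => tlist (rev (tseq (f x)))).
Proof.
move=> Ff; apply: FP_ext (FP_fold (g := fun _ a e => Node e a) Ff FP_Leaf _ _).
- by move=> x; rewrite (foldl_push id) map_id cats0.
- exact: FP_node (FP_right FP_id) (FP_right (FP_left FP_id)).
have [k z] := FP_size_bound Ff; exists (fun n => (n + 2) ^ k + 1); first by pb.
by move=> x acc e /=; have := z x; lia.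
Qed.

Lemma FP_map l h : FP l -> FP (fun z => h (tleft z) (tright z)) ->
  FP (fun x => tlist [seq h x e | e <- tseq (l x)]).
Proof.
move=> Fl Fh.
apply: (@FP_ext (fun x => tlist (rev (tseq (foldl (fun a e => Node (h x e) a) Leaf (tseq (l x))))))).
  by move=> x; rewrite foldl_push tlistK cats0 revK.
apply: FP_rev; apply: (FP_fold (g := fun x a e => Node (h x e) a)) => //.
- exact: FP_Leaf.
- apply: FP_node; last exact: FP_right (FP_left FP_id).
  exact: FP_app2 Fh (FP_left (FP_left FP_id)) (FP_right FP_id).
have [k z] := FP_size_bound Fh; have [kl zl] := FP_size_bound Fl.
exists (fun n => (n + (n + 2) ^ kl + 1 + 2) ^ k + 1); first by pb.
move=> x acc e le /=; have := z (Node x e); rewrite /=.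
have : ((tsize x + tsize e).+1 + 2) ^ k <= (tsize x + (tsize x + 2) ^ kl + 1 + 2) ^ k.
  by apply: pow_mono; have := zl x; lia.
by lia.
Qed.

Lemma foldl_filter p a s :
  foldl (fun a e => if p e then Node e a else a) a s
  = tlist (rev (filter p s) ++ tseq a).
Proof.
elim: s a => [|e s IH] a /=; first by rewrite tseqK.
by rewrite IH; case: (p e) => //=; rewrite rev_cons cat_rcons.
Qed.

Lemma FP_filter l p : FP l -> FPB (fun z => p (tleft z) (tright z)) ->
  FP (fun x => tlist [seq e <- tseq (l x) | p x e]).
Proof.
move=> Fl Fp.
apply: (@FP_ext (fun x => tlist (rev (tseq
   (foldl (fun a e => if p x e then Node e a else a) Leaf (tseq (l x))))))).
  by move=> x; rewrite foldl_filter tlistK cats0 revK.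
apply: FP_rev; apply: (FP_fold (g := fun x a e => if p x e then Node e a else a)) => //.
- exact: FP_Leaf.
- apply: FP_if; last exact: FP_right (FP_left FP_id).
    exact: FPB_app2 Fp (FP_left (FP_left FP_id)) (FP_right FP_id).
  exact: FP_node (FP_right FP_id) (FP_right (FP_left FP_id)).
have [kl zl] := FP_size_bound Fl.
exists (fun n => (n + 2) ^ kl + 1); first by pb.
by move=> x acc e le /=; have := zl x; case: ifP => /=; lia.
Qed.

Lemma FPB_has l p : FP l -> FPB (fun z => p (tleft z) (tright z)) ->
  FPB (fun x => has (p x) (tseq (l x))).
Proof.
move=> Fl Fp; apply: FP_ext (FPB_isnode (FP_filter Fl Fp)) => x /=; congr enc_bool.
by elim: (tseq (l x)) => //= e s <-; case: (p x e).
Qed.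

Lemma FPB_all l p : FP l -> FPB (fun z => p (tleft z) (tright z)) ->
  FPB (fun x => all (p x) (tseq (l x))).
Proof.
move=> Fl Fp; apply: FP_ext (FPB_neg (FPB_has Fl (p := fun x e => ~~ p x e) (FPB_neg Fp))) => x /=.
by rewrite -[has _ _]/(has (predC (p x)) _) has_predC negbK.
Qed.

Lemma FP_cat f g : FP f -> FP g -> FP (fun x => tlist (tseq (f x) ++ tseq (g x))).
Proof.
move=> Ff Fg.
apply: (@FP_ext (fun x => foldl (fun a e => Node e a) (g x)
   (tseq (tlist (rev (tseq (f x))))))).
  by move=> x; rewrite (foldl_push id) map_id tlistK revK.
apply: (FP_fold (g := fun _ a e => Node e a)) => //; first exact: FP_rev.
- exact: FP_node (FP_right FP_id) (FP_right (FP_left FP_id)).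
have [k z] := FP_size_bound (FP_rev Ff); exists (fun n => (n + 2) ^ k + 1); first by pb.
by move=> x acc e /=; have := z x; lia.
Qed.

Lemma FP_flatmap l h : FP l -> FP (fun z => h (tleft z) (tright z)) ->
  FP (fun x => tlist (flatten [seq tseq (h x e) | e <- tseq (l x)])).
Proof.
move=> Fl Fh.
apply: (@FP_ext (fun x => foldl (fun a e => tlist (tseq a ++ tseq e)) Leaf
   (tseq (tlist [seq h x e | e <- tseq (l x)])))).
  move=> x; rewrite tlistK.
  suff gen s a : foldl (fun a e => tlist (tseq a ++ tseq e)) a (map (h x) s)
      = tlist (tseq a ++ flatten [seq tseq (h x e) | e <- s]) by rewrite gen.
  by elim: s a => [|e s IH] a /=; rewrite ?cats0 ?tseqK // IH tlistK catA.
apply: (FP_fold (g := fun _ a e => tlist (tseq a ++ tseq e))).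
- exact: FP_map.
- exact: FP_Leaf.
- exact: FP_cat (FP_right (FP_left FP_id)) (FP_right FP_id).
have [k z] := FP_size_bound (FP_map Fl Fh); exists (fun n => (n + 2) ^ k); first by pb.
move=> x acc e le; apply: (leq_trans (n := tsize acc + tsize e)).
  by rewrite -{2}(tseqK acc) -{2}(tseqK e) !tsize_list big_cat /=; lia.
by have := z x; lia.
Qed.

(** Dropping a unary index reads a characteristic vector at that position, and also compares two
    numerals. *)
Lemma FP_drop f g : FP f -> FP g ->
  FP (fun x => tlist (drop (size (tseq (f x))) (tseq (g x)))).
Proof.
move=> Ff Fg.
apply: (@FP_ext (fun x => foldl (fun a _ => tright a) (g x) (tseq (f x)))).
  move=> x; elim: (tseq (f x)) (g x) => [|e s IH] a /=; first by rewrite drop0 tseqK.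
  by rewrite IH; case: a.
apply: (FP_fold (g := fun _ a _ => tright a)) => //.
- exact: FP_right (FP_right (FP_left FP_id)).
by exists (fun=> 0); [pb|move=> x acc e _; have := tsize_right acc; lia].
Qed.

Definition tuniv n := tlist (map enc_nat (iota 0 n)).

Lemma tsize_tuniv n : tsize (tuniv n) <= n * (n * 2 + 2) + 1.
Proof.
suff gen m : tsize (tlist (map enc_nat (iota m n))) <= n * ((m + n) * 2 + 2) + 1.
  exact: gen.
elim: n m => //= n IH m; rewrite -/(tlist _) tsize_enc_nat.
have := IH m.+1; rewrite addSnnS mulSn; lia.
Qed.

Lemma map_leaf U (s : seq U) : [seq Leaf | _ <- s] = nseq (size s) Leaf.
Proof. by elim: s => //= a s ->. Qed.

Lemma FP_univ f : FP f -> FP (fun x => tuniv (size (tseq (f x)))).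
Proof.
move=> Ff.
(* The next numeral is the length of the accumulator, in unary; list elements only count. As the
   growth depends on the accumulator, the closed form [tuniv] is bounded instead. *)
pose g (x a e : tree) := tlist (tseq a ++ tseq (Node (tlist [seq Leaf | e <- tseq a]) Leaf)).
have foldE x s : foldl (g x) Leaf s = tuniv (size s).
  elim/last_ind: s => // s e IH; rewrite foldl_rcons IH size_rcons /g /tuniv.
  by rewrite !tlistK map_leaf size_map size_iota -enc_nat_list -addn1 iotaD map_cat.
apply: FP_ext (FP_fold_bound (g := g) Ff FP_Leaf _ _) => //.
- apply: FP_cat; first exact: FP_right (FP_left FP_id).
  apply: FP_node FP_Leaf.
  by apply: (FP_map (h := fun _ _ => Leaf)); [exact: FP_right (FP_left FP_id)|exact: FP_Leaf].
have [k z] := FP_size_bound Ff.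
exists (fun n => (n + 2) ^ k * ((n + 2) ^ k * 2 + 2) + 1); first by pb.
move=> x i; rewrite foldE; apply: leq_trans (tsize_tuniv _) _.
have le : size (take i (tseq (f x))) <= (tsize x + 2) ^ k.
  by rewrite size_take_min; have := size_tseq (f x); have := z x; lia.
by rewrite leq_add2r leq_mul // leq_add2r leq_mul2r le.
Qed.

Lemma size_tseq_nat k : size (tseq (enc_nat k)) = k.
Proof. by rewrite enc_nat_list tlistK size_nseq. Qed.

Lemma FP_mul f g : FP (fun x => enc_nat (f x)) -> FP (fun x => enc_nat (g x)) ->
  FP (fun x => enc_nat (f x * g x)).
Proof.
move=> Ff Fg.
have Fg' : FP (fun z => enc_nat (g (tleft z))) by apply: (FP_comp Fg (FP_left FP_id)).
apply: FP_ext (FP_flatmap (h := fun x _ => enc_nat (g x)) Ff Fg') => x.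
rewrite [RHS]enc_nat_list; congr tlist; rewrite [enc_nat (f x)]enc_nat_list tlistK.
by elim: (f x) => //= m ->; rewrite enc_nat_list tlistK -nseqD.
Qed.

Lemma FP_clock f k : FP f -> FP (fun x => enc_nat ((tsize (f x) + 2) ^ k)).
Proof.
move=> Ff; have Fs := FP_comp FP_tsize Ff.
elim: k => [|k IH]; first exact: FP_node FP_Leaf FP_Leaf.
have F2 : FP (fun x => enc_nat (tsize (f x) + 2)).
  by apply: FP_ext (FP_node FP_Leaf (FP_node FP_Leaf Fs)) => x; rewrite addn2.
by apply: FP_ext (FP_mul F2 IH) => x; rewrite expnS.
Qed.

(** * Set operations on encodings *)

(* [U] encodes the list of all elements, [L] the list of the irreducible closed
   sets. *)
Definition tdrop i A := tlist (drop (size (tseq i)) (tseq A)).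
Definition tmem i A := isnode (tleft (tdrop i A)).
Definition teqn i j := ~~ isnode (tdrop i j) && ~~ isnode (tdrop j i).
Definition tsub U A B := all (fun i => tmem i A ==> tmem i B) (tseq U).
Definition teqs U A B := tsub U A B && tsub U B A.
Definition tset U (b : pred tree) := tlist [seq enc_bool (b i) | i <- tseq U].
Definition tsetD1 U K a := tset U (fun i => tmem i K && ~~ teqn i a).
Definition tclosed U L K :=
  all (fun y => tmem y K || has (fun N => tsub U K N && ~~ tmem y N) (tseq L))
    (tseq U).
Definition tirr U L y :=
  tlist [seq N <- tseq L | ~~ tmem y N &&
    all (fun N' => tmem y N' || ~~ tsub U N N' || tsub U N' N) (tseq L)].
Definition tgstep U L x K a :=
  if [&& ~~ teqn a x, tmem a K, tclosed U L (tsetD1 U K a)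
       & ~~ tclosed U L (tsetD1 U (tsetD1 U K a) x)]
  then tsetD1 U K a else K.
Definition tgpass U L x K := foldl (tgstep U L x) K (tseq U).
Definition tgreedy U L x K := foldl (fun K _ => tgpass U L x K) K (tseq U).
Definition text U L K :=
  tset U (fun a => tmem a K && tclosed U L (tsetD1 U K a)).
(** The keys of the input table are the critical ancestors of [x], so [P] is read off rather than
    computed from a critical base. *)
Definition tkeys U Tab := tset U (fun i => has (fun r => teqn i (tleft r)) (tseq Tab)).

Lemma FPB_tmem f g : FP f -> FP g -> FPB (fun x => tmem (f x) (g x)).
Proof. by move=> Ff Fg; apply: FPB_isnode; apply: FP_left; apply: FP_drop. Qed.

Lemma FPB_teqn f g : FP f -> FP g -> FPB (fun x => teqn (f x) (g x)).
Proof.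
move=> Ff Fg; apply: FPB_and; apply: FPB_neg; apply: FPB_isnode; exact: FP_drop.
Qed.

Lemma FP_tset u b : FP u -> FPB (fun z => b (tleft z) (tright z)) ->
  FP (fun x => tset (u x) (b x)).
Proof. by move=> Fu Fb; apply: (FP_map (h := fun x e => enc_bool (b x e))). Qed.

Ltac fp_set := fail.
Ltac fp_step := first [fp_set | exact FP_id | exact FP_Leaf
  | exact FPB_true | assumption |
  lazymatch goal with
  | |- FP (fun x => tleft (@?f x)) => apply (@FP_left f)
  | |- FP (fun x => tright (@?f x)) => apply (@FP_right f)
  | |- FP (fun x => Node (@?f x) (@?g x)) => apply (@FP_node f g)
  | |- FP (fun x => tset (@?u x) (@?b x)) => apply (@FP_tset u b)
  | |- FPB (fun x => ~~ @?b x) => apply (@FPB_neg b)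
  | |- FPB (fun x => @?a x && @?b x) => apply (@FPB_and a b)
  | |- FPB (fun x => @?a x || @?b x) => apply (@FPB_or a b)
  | |- FPB (fun x => @?a x ==> @?b x) => apply (@FPB_imp a b)
  | |- FPB (fun x => isnode (@?f x)) => apply (@FPB_isnode f)
  | |- FPB (fun x => has (@?p x) (tseq (@?l x))) => apply (@FPB_has l p)
  | |- FPB (fun x => all (@?p x) (tseq (@?l x))) => apply (@FPB_all l p)
  | |- FPB (fun x => tmem (@?f x) (@?g x)) => apply (@FPB_tmem f g)
  | |- FPB (fun x => teqn (@?f x) (@?g x)) => apply (@FPB_teqn f g)
  | H : FP ?f |- FP (fun x => ?f (@?g x)) => apply (@FP_comp f g H)
  end]; cbv beta.
Ltac fp := repeat fp_step.

Lemma FPB_tsub u f g : FP u -> FP f -> FP g -> FPB (fun x => tsub (u x) (f x) (g x)).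
Proof. by move=> Fu Ff Fg; rewrite /tsub; fp. Qed.

Ltac fp_set ::= lazymatch goal with
  | |- FPB (fun x => tsub (@?u x) (@?f x) (@?g x)) => apply (@FPB_tsub u f g)
  end.

Lemma FPB_teqs u f g : FP u -> FP f -> FP g -> FPB (fun x => teqs (u x) (f x) (g x)).
Proof. by move=> Fu Ff Fg; rewrite /teqs; fp. Qed.

Lemma FP_tsetD1 u f g : FP u -> FP f -> FP g -> FP (fun x => tsetD1 (u x) (f x) (g x)).
Proof. by move=> Fu Ff Fg; rewrite /tsetD1; fp. Qed.

Lemma FPB_tclosed u l f : FP u -> FP l -> FP f -> FPB (fun x => tclosed (u x) (l x) (f x)).
Proof. by move=> Fu Fl Ff; rewrite /tclosed; fp. Qed.

Lemma FP_tirr u l f : FP u -> FP l -> FP f -> FP (fun x => tirr (u x) (l x) (f x)).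
Proof.
move=> Fu Fl Ff; apply: (FP_filter (p := fun x N => ~~ tmem (f x) N &&
    all (fun N' => tmem (f x) N' || ~~ tsub (u x) N N' || tsub (u x) N' N) (tseq (l x)))) => //.
by fp.
Qed.

Ltac fp_set ::= lazymatch goal with
  | |- FPB (fun x => tsub (@?u x) (@?f x) (@?g x)) => apply (@FPB_tsub u f g)
  | |- FPB (fun x => teqs (@?u x) (@?f x) (@?g x)) => apply (@FPB_teqs u f g)
  | |- FPB (fun x => tclosed (@?u x) (@?f x) (@?g x)) => apply (@FPB_tclosed u f g)
  | |- FP (fun x => tsetD1 (@?u x) (@?f x) (@?g x)) => apply (@FP_tsetD1 u f g)
  | |- FP (fun x => tirr (@?u x) (@?f x) (@?g x)) => apply (@FP_tirr u f g)
  end.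

Lemma FP_text u l f : FP u -> FP l -> FP f -> FP (fun x => text (u x) (l x) (f x)).
Proof. by move=> Fu Fl Ff; rewrite /text; fp. Qed.

Lemma FP_tkeys u l : FP u -> FP l -> FP (fun x => tkeys (u x) (l x)).
Proof. by move=> Fu Fl; rewrite /tkeys; fp. Qed.

(** The bound does not involve [b]: a recomputed set never outgrows a vector over [U], which keeps
    the growth in the greedy loops additive. *)
Lemma tsize_tset U b : tsize (tset U b) <= 4 * tsize U.
Proof.
rewrite /tset; apply: (leq_trans (n := 4 * size (tseq U) + 1)); last first.
  by have := size_tseq U; lia.
by elim: (tseq U) => //= a s; rewrite -/(tlist _); case: (b a) => /=; lia.
Qed.

Lemma tsize_tgstep U L x K a : tsize (tgstep U L x K a) <= tsize K + 4 * tsize U.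
Proof.
have := tsize_tset U (fun i => tmem i K && ~~ teqn i a).
by rewrite /tgstep -/(tsetD1 U K a); case: ifP => _; lia.
Qed.

Lemma FP_tgpass u l f k : FP u -> FP l -> FP f -> FP k ->
  FP (fun x => tgpass (u x) (l x) (f x) (k x)).
Proof.
move=> Fu Fl Ff Fk.
apply: (FP_fold (g := fun x K a => tgstep (u x) (l x) (f x) K a)) => //.
  by rewrite /tgstep; apply: FP_if; fp.
have [m z] := FP_size_bound Fu; exists (fun n => 4 * (n + 2) ^ m); first by pb.
by move=> x K a _; have := tsize_tgstep (u x) (l x) (f x) K a; have := z x; lia.
Qed.

Lemma FP_tgreedy u l f k : FP u -> FP l -> FP f -> FP k ->
  FP (fun x => tgreedy (u x) (l x) (f x) (k x)).
Proof.
move=> Fu Fl Ff Fk.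
apply: (FP_fold (g := fun x K _ => tgpass (u x) (l x) (f x) K)) => //.
  by apply: FP_tgpass; fp.
have [m z] := FP_size_bound Fu.
exists (fun n => (n + 2) ^ m * (4 * (n + 2) ^ m)); first by pb.
move=> x K _ _.
have := foldl_bound K (tseq_small (u x)) (fun K a _ => tsize_tgstep (u x) (l x) (f x) K a).
move=> le; apply: leq_trans le _; rewrite leq_add2l; apply: leq_mul; last by rewrite leq_mul2l z.
by have := size_tseq (u x); have := z x; lia.
Qed.

(** * The reduction *)

Definition in_n z := tleft z.
Definition in_irr z := tleft (tright z).
Definition in_x z := tleft (tright (tright z)).
Definition in_tab z := tleft (tright (tright (tright z))).
Definition in_fam z := tright (tright (tright (tright z))).
Definition in_univ z := tuniv (size (tseq (in_n z))).

Definition sing U y := tset U (fun i => teqn i y).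

Definition red_ib z :=
  Node (Node (tkeys (in_univ z) (in_tab z)) (sing (in_univ z) (in_x z)))
   (tlist ([seq Node A (sing (in_univ z) (in_x z)) | A <- tseq (in_fam z)] ++
     flatten [seq [seq Node A (sing (in_univ z) (tleft r)) | A <- tseq (tright r)]
       | r <- tseq (in_tab z)])).

Definition red_table z :=
  tlist [seq Node (tleft r) (tirr (in_univ z) (in_irr z) (tleft r)) | r <- tseq (in_tab z)].

Definition reduction z := Node (in_n z) (Node (red_ib z) (Node (in_x z) (red_table z))).

Definition trivial_case z := ~~ isnode (in_fam z) ||
  has (fun A => teqs (in_univ z) A (tkeys (in_univ z) (in_tab z))) (tseq (in_fam z)).

(* In the trivial cases the clock is 0: the enumeration program is never run on
   an input that is not an instance, where its outputs could be huge. *)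
Definition preproc k z := Node z (if trivial_case z then Leaf else
  Node (reduction z) (enc_nat ((tsize (Node (reduction z) z) + 2) ^ k))).

Definition new_sets z outs :=
  tlist [seq M <- tseq outs |
    ~~ has (fun N => teqs (in_univ z) M N) (tseq (tirr (in_univ z) (in_irr z) (in_x z)))].

Definition extract z K :=
  Node (text (in_univ z) (in_irr z) (tgreedy (in_univ z) (in_irr z) (in_x z) K)) Leaf.

(** For empty [F], a nonempty table means that [x] has a critical ancestor, hence a critical
    generator, and the removal starts from the full set. *)
Definition postproc w :=
  let z := tleft w in
  let new := new_sets z (tright w) in
  if isnode (in_fam z) then
    if isnode new then
      extract z (tset (in_univ z) (fun i => tmem i (tleft new) || teqn i (in_x z)))
    else Leaf
  else if isnode (in_tab z) then extract z (tset (in_univ z) (fun=> true)) else Leaf.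

Lemma FP_in_univ f : FP f -> FP (fun x => in_univ (f x)).
Proof. by move=> Ff; apply: (@FP_univ (fun x => tleft (f x))); fp. Qed.

Lemma FP_sing u f : FP u -> FP f -> FP (fun x => sing (u x) (f x)).
Proof. by move=> Fu Ff; rewrite /sing; fp. Qed.

Lemma FP_extract f k : FP f -> FP k -> FP (fun x => extract (f x) (k x)).
Proof.
move=> Ff Fk; rewrite /extract /in_irr /in_x; apply: FP_node FP_Leaf.
by apply: FP_text; [exact: FP_in_univ|fp|apply: FP_tgreedy; fp; exact: FP_in_univ].
Qed.

Ltac fp_set ::= lazymatch goal with
  | |- FPB (fun x => tsub (@?u x) (@?f x) (@?g x)) => apply (@FPB_tsub u f g)
  | |- FPB (fun x => teqs (@?u x) (@?f x) (@?g x)) => apply (@FPB_teqs u f g)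
  | |- FP (fun x => tirr (@?u x) (@?f x) (@?g x)) => apply (@FP_tirr u f g)
  | |- FP (fun x => tkeys (@?u x) (@?f x)) => apply (@FP_tkeys u f)
  | |- FP (fun x => in_univ (@?f x)) => apply (@FP_in_univ f)
  | |- FP (fun x => sing (@?u x) (@?f x)) => apply (@FP_sing u f)
  | |- FP (fun x => extract (@?u x) (@?f x)) => apply (@FP_extract u f)
  end.

Lemma FP_reduction : FP reduction.
Proof.
rewrite /reduction; apply: FP_node; first by rewrite /in_n; fp.
apply: FP_node; last apply: FP_node.
- rewrite /red_ib; apply: FP_node; first by rewrite /in_tab /in_x; fp.
  apply: (@FP_ext (fun z => tlist (
     tseq (tlist [seq Node A (sing (in_univ z) (in_x z)) | A <- tseq (in_fam z)]) ++
     tseq (tlist (flatten [seq tseq (tlist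
         [seq Node A (sing (in_univ z) (tleft r)) | A <- tseq (tright r)])
       | r <- tseq (in_tab z)]))))).
    by move=> z; rewrite !tlistK; congr (tlist (_ ++ flatten _)); apply: eq_map => r; rewrite tlistK.
  apply: FP_cat.
    by apply: (@FP_map in_fam (fun z A => Node A (sing (in_univ z) (in_x z))));
      rewrite /in_fam /in_x; fp.
  apply: (@FP_flatmap in_tab (fun z r => tlist
    [seq Node A (sing (in_univ z) (tleft r)) | A <- tseq (tright r)])).
    by rewrite /in_tab; fp.
  by apply: (@FP_map (fun z => tright (tright z))
    (fun z A => Node A (sing (in_univ (tleft z)) (tleft (tright z))))); fp.
- by rewrite /in_x; fp.
by apply: (@FP_map in_tab (fun z r => Node (tleft r) (tirr (in_univ z) (in_irr z) (tleft r))));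
  rewrite /in_tab /in_irr; fp.
Qed.

Lemma FP_preproc k : FP (preproc k).
Proof.
rewrite /preproc; apply: FP_node FP_id _; apply: FP_if.
- by rewrite /trivial_case /in_fam /in_tab; fp.
- exact: FP_Leaf.
apply: FP_node FP_reduction _; apply: FP_clock; exact: FP_node FP_reduction FP_id.
Qed.

Lemma FP_postproc : FP postproc.
Proof.
have Fnew : FP (fun w => new_sets (tleft w) (tright w)).
  apply: (@FP_filter (fun w => tright w) (fun w M => ~~ has (fun N => teqs (in_univ (tleft w)) M N)
    (tseq (tirr (in_univ (tleft w)) (in_irr (tleft w)) (in_x (tleft w)))))).
    by fp.
  by rewrite /in_irr /in_x; fp.
rewrite /postproc; apply: FP_if; first by rewrite /in_fam; fp.
  apply: FP_if; [by fp| |by fp].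
  rewrite /in_x; fp.
  exact: (FP_comp Fnew (FP_left FP_id)).
apply: FP_if; [by rewrite /in_tab; fp| |by fp].
by fp.
Qed.

(** * Correctness on encodings *)

Lemma uniq_map_inj (T1 T2 : eqType) (f : T1 -> T2) s :
  uniq (map f s) -> {in s &, injective f}.
Proof.
elim: s => //= a s IH /andP[fa us] u v; rewrite !inE.
case/predU1P=> [->|us_]; case/predU1P=> [->|vs_] // e; last exact: IH.
  by rewrite e map_f in fa.
by rewrite -e map_f in fa.
Qed.

Section Encodings.
Variable n : nat.
Implicit Types (i j x y a : 'I_n) (A B K N : {set 'I_n}).

Notation U := (tuniv n).
Notation esets := (enc_seq (@enc_set n)).

Lemma tseq_univ : tseq U = [seq enc_elt i | i <- enum 'I_n].
Proof.
rewrite /tuniv tlistK -val_enum_ord -map_comp.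
by apply: eq_map.
Qed.

Lemma tseq_sets (s : seq {set 'I_n}) : tseq (esets s) = [seq enc_set A | A <- s].
Proof. by rewrite enc_seqE tlistK. Qed.

Lemma tmem_enc i A : tmem (enc_elt i) (enc_set A) = (i \in A).
Proof.
rewrite /tmem /tdrop size_tseq_nat /enc_set enc_seqE tlistK -map_comp.
have -> (s : seq tree) : tleft (tlist s) = nth Leaf s 0 by case: s.
rewrite nth_drop addn0 (nth_map i) ?size_enum_ord ?ltn_ord //= nth_ord_enum.
by case: (i \in A).
Qed.

Lemma isnode_tdrop_nat k l : isnode (tdrop (enc_nat k) (enc_nat l)) = (k < l).
Proof.
rewrite /tdrop size_tseq_nat enc_nat_list tlistK drop_nseq.
by case: (l - k) (subn_gt0 k l) => [|m].
Qed.

Lemma teqn_enc i j : teqn (enc_elt i) (enc_elt j) = (i == j).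
Proof.
by rewrite /teqn /enc_elt !isnode_tdrop_nat -!leqNgt -val_eqE /= eqn_leq andbC.
Qed.

Lemma tset_enc (b : pred tree) B :
  (forall i, b (enc_elt i) = (i \in B)) -> tset U b = enc_set B.
Proof.
move=> bB; rewrite /tset tseq_univ /enc_set enc_seqE -!map_comp.
by congr tlist; apply: eq_map => i /=; rewrite bB.
Qed.

Lemma all_univ (p : pred tree) (q : pred 'I_n) :
  (forall i, p (enc_elt i) = q i) -> all p (tseq U) = [forall i, q i].
Proof.
move=> pq; rewrite tseq_univ all_map; apply/allP/forallP => [h i|h i _] /=.
  by rewrite -pq; apply: (h i); rewrite mem_enum.
by rewrite pq.
Qed.

Lemma has_sets (p : pred tree) (q : pred {set 'I_n}) s :
  (forall A, p (enc_set A) = q A) -> has p (tseq (esets s)) = has q s.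
Proof. by move=> pq; rewrite tseq_sets has_map; apply: eq_has => A /=; rewrite pq. Qed.

Lemma all_sets (p : pred tree) (q : pred {set 'I_n}) s :
  (forall A, p (enc_set A) = q A) -> all p (tseq (esets s)) = all q s.
Proof. by move=> pq; rewrite tseq_sets all_map; apply: eq_all => A /=; rewrite pq. Qed.

Lemma tsub_enc A B : tsub U (enc_set A) (enc_set B) = (A \subset B).
Proof.
rewrite /tsub (all_univ (q := fun i => (i \in A) ==> (i \in B))).
  by apply/forallP/subsetP => h i; [apply/implyP|apply/implyP]; apply: h.
by move=> i; rewrite !tmem_enc.
Qed.

Lemma teqs_enc A B : teqs U (enc_set A) (enc_set B) = (A == B).
Proof. by rewrite /teqs !tsub_enc eqEsubset. Qed.

Lemma tsetD1_enc K a : tsetD1 U (enc_set K) (enc_elt a) = enc_set (K :\ a).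
Proof. by apply: tset_enc => i; rewrite tmem_enc teqn_enc !inE andbC. Qed.

Lemma sing_enc y : sing U (enc_elt y) = enc_set [set y].
Proof. by apply: tset_enc => i; rewrite teqn_enc inE. Qed.

Lemma tkeys_enc (tab : seq ('I_n * seq {set 'I_n})) (D : {set 'I_n}) :
  perm_eq [seq r.1 | r <- tab] (enum D) -> tkeys U (enc_table tab) = enc_set D.
Proof.
move=> tabD; apply: tset_enc => i; rewrite -mem_enum -(perm_mem tabD).
rewrite /enc_table enc_seqE tlistK has_map; apply/hasP/mapP => [[r rt]|[r rt ->]].
  by rewrite /= teqn_enc => /eqP ->; exists r.
by exists r => //=; rewrite teqn_enc.
Qed.

Section System.
Variables (C : {set {set 'I_n}}) (l : seq {set 'I_n}).
Hypothesis Ccs : closure_system C.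
Hypothesis lC : perm_eq l (enum (irr_sys C)).

Let mem_l N : (N \in l) = (N \in irr_sys C).
Proof. by rewrite (perm_mem lC) mem_enum. Qed.

Lemma tclosed_enc K : tclosed U (esets l) (enc_set K) = (K \in C).
Proof.
rewrite (closed_by_irr Ccs); apply: all_univ => y; rewrite tmem_enc; congr (_ || _).
rewrite (has_sets (q := fun N => (K \subset N) && (y \notin N))); last first.
  by move=> N; rewrite tsub_enc tmem_enc.
by apply/hasP/existsP => [[N]|[N /andP[]]]; [rewrite mem_l|]; exists N; rewrite ?mem_l //; apply/andP.
Qed.

Lemma tirr_enc y :
  tirr U (esets l) (enc_elt y) = esets [seq N <- l | N \in irr C y].
Proof.
rewrite /tirr [LHS]/= [RHS]enc_seqE tseq_sets filter_map; congr (tlist (map _ _)).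
apply: eq_in_filter => N; rewrite mem_l => Nl /=.
rewrite tmem_enc irr_by_sys Nl /= -tseq_sets; congr (_ && _).
rewrite (all_sets (q := fun N' => (y \in N') || ~~ (N \subset N') || (N' \subset N))); last first.
  by move=> N'; rewrite tmem_enc !tsub_enc.
apply/allP/forallP => h N'; last by rewrite mem_l; apply: (implyP (h N')).
by apply/implyP => N'l; apply: h; rewrite mem_l.
Qed.

Lemma tgstep_enc x K a :
  tgstep U (esets l) (enc_elt x) (enc_set K) (enc_elt a) = enc_set (gstep C x K a).
Proof.
rewrite /tgstep /gstep teqn_enc tmem_enc !tsetD1_enc !tclosed_enc setDDl.
by case: ifP.
Qed.

Lemma tgpass_enc x K :
  tgpass U (esets l) (enc_elt x) (enc_set K) = enc_set (gpass C x K).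
Proof.
rewrite /tgpass /gpass tseq_univ; elim: (enum 'I_n) K => //= a s IH K.
by rewrite tgstep_enc IH.
Qed.

Lemma tgreedy_enc x K :
  tgreedy U (esets l) (enc_elt x) (enc_set K) = enc_set (greedy C x K).
Proof.
rewrite /tgreedy /greedy cardE tseq_univ.
elim: (enum 'I_n) K => //= a s IH K.
by rewrite tgpass_enc IH -iterSr.
Qed.

Lemma text_enc K : text U (esets l) (enc_set K) = enc_set (ext C K).
Proof.
by apply: tset_enc => i; rewrite inE tmem_enc tsetD1_enc tclosed_enc.
Qed.
End System.

(** * The reduction on an encoded instance *)

Section Instance.
Variables (I : cge_input n) (C F : {set {set 'I_n}}).
Hypothesis CI : cge_instance I C F.
Let x := cge_x I.
Let P := critanc C x.
Let z := enc_cge I.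

Lemma cge_system : closure_system C.
Proof. by case: CI => [[]]. Qed.

Lemma cge_univ : in_univ z = U.
Proof. by rewrite /in_univ /in_n /= size_tseq_nat. Qed.

Lemma cge_fields : (in_irr z = esets (cge_irr I)) * (in_x z = enc_elt x) *
  (in_tab z = enc_table (cge_anc I)) * (in_fam z = esets (cge_fam I)).
Proof. by []. Qed.

Definition red_rules : seq ({set 'I_n} * {set 'I_n}) :=
  (P, [set x]) :: [seq (A, [set x]) | A <- cge_fam I] ++
    [seq (A, [set r.1]) | r <- cge_anc I, A <- r.2].

Definition red_set : implications 'I_n := [set q in red_rules].

Definition red_input : acs_input n :=
  AcsInput red_rules x [seq (r.1, [seq N <- cge_irr I | N \in irr C r.1]) | r <- cge_anc I].

Lemma reduction_enc : reduction z = enc_acs red_input.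
Proof.
case: CI => _ Irr [keys _] _ _.
rewrite /reduction /enc_acs; congr (Node _ (Node _ (Node _ _))).
- rewrite /red_ib cge_univ !cge_fields.
  rewrite (tkeys_enc keys) sing_enc.
  pose f := enc_pair (@enc_set n) (@enc_set n).
  have -> : enc_seq f (acs_ib red_input) = Node (f (P, [set x]))
      (tlist [seq f q | q <- [seq (A, [set x]) | A <- cge_fam I] ++
        [seq (A, [set r.1]) | r <- cge_anc I, A <- r.2]]) by rewrite enc_seqE.
  congr (Node _ (tlist _)).
  rewrite map_cat tseq_sets -!map_comp; congr (_ ++ _).
  rewrite map_flatten -map_comp /enc_table enc_seqE tlistK -map_comp.
  congr flatten; apply: eq_map => r /=.
  by rewrite tseq_sets sing_enc -!map_comp.
rewrite /red_table cge_univ !cge_fields /enc_table [RHS]enc_seqE.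
rewrite [enc_seq (enc_pair _ _) (cge_anc I)]enc_seqE tlistK.
congr tlist; rewrite -!map_comp; apply: eq_map => r /=.
by rewrite (tirr_enc Irr).
Qed.

Lemma trivial_caseE : trivial_case z = (F == set0) || (P \in F).
Proof.
case: CI => _ _ [keys _] famF _.
have memF A : (A \in cge_fam I) = (A \in F) by rewrite (perm_mem famF) mem_enum.
rewrite /trivial_case cge_univ !cge_fields (tkeys_enc keys).
congr (_ || _).
  rewrite -cards_eq0 cardE -(perm_size famF).
  by case: (cge_fam I).
rewrite (has_sets (q := pred1 P)) ?has_pred1 ?memF // => A.
by rewrite teqs_enc.
Qed.

Lemma red_setP q : reflect
  [\/ exists y, [/\ y \in P, q.2 = [set y] & q.1 \in critgen C y],
      q.2 = [set x] /\ q.1 \in F | q = (P, [set x])] (q \in red_set).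
Proof.
case: CI => _ _ [keys tab] famF _.
have memF A : (A \in cge_fam I) = (A \in F) by rewrite (perm_mem famF) mem_enum.
have memP y : (y \in [seq r.1 | r <- cge_anc I]) = (y \in P).
  by rewrite (perm_mem keys) mem_enum.
rewrite inE /red_rules inE mem_cat.
apply: (iffP or3P) => [[/eqP ->|/mapP[A]|/allpairsPdep[r [A [rt Ar ->]]]]|].
- by constructor 3.
- by rewrite memF => AF ->; constructor 2.
- constructor 1; exists r.1; split=> //=; first by rewrite -memP map_f.
  by rewrite -mem_enum -(perm_mem (tab _ rt)).
case: q => A B /= [[y [yP -> Ac]]|[-> AF]|->]; last by constructor 1.
  constructor 3; rewrite -memP in yP; case/mapP: yP => r rt ey.
  apply/allpairsPdep; exists r, A; split=> //; last by rewrite ey.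
  by rewrite (perm_mem (tab _ rt)) mem_enum -ey.
by constructor 2; apply: map_f; rewrite memF.
Qed.

Lemma new_sets_enc (l : seq {set 'I_n}) :
  new_sets z (esets l) = esets [seq M <- l | M \notin irr C x].
Proof.
case: CI => _ Irr _ _ _.
rewrite /new_sets cge_univ !cge_fields (tirr_enc Irr) [RHS]enc_seqE [tseq (esets l)]tseq_sets filter_map.
congr (tlist (map _ _)); apply: eq_filter => M /=; congr (~~ _).
rewrite (has_sets (q := pred1 M)); last by move=> A; rewrite teqs_enc eq_sym.
rewrite has_pred1 mem_filter (perm_mem Irr) mem_enum andb_idr //.
exact: subsetP (irr_sub_sys C _) M.
Qed.

Lemma extract_enc K : extract z (enc_set K)
  = enc_option (@enc_set n) (Some (ext C (greedy C x K))).
Proof.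
case: (CI) => _ Irr _ _ _; have Ccs := cge_system.
by rewrite /extract cge_univ !cge_fields (tgreedy_enc Ccs Irr) (text_enc Ccs Irr).
Qed.

Lemma postproc_trivial (S : implications 'I_n) r :
  ranks S r -> C = closed_sets S -> (F == set0) || (P \in F) ->
  exists2 a, cge_answer C F x a &
    postproc (Node z Leaf) = enc_option (@enc_set n) a.
Proof.
move=> rS CS; case: (CI) => _ Irr [keys _] famF Fc.
have Ccs := cge_system; rewrite CS in Ccs.
rewrite /postproc [tleft _]/= [tright _]/= (new_sets_enc [::]) /=.
have [F0 _|F0 /= PF] := eqVneq F set0; last first.
  exists None; last by case: ifP => // /negP[]; rewrite cge_fields;
    move: F0; rewrite -cards_eq0 cardE -(perm_size famF); case: (cge_fam I).
  apply/eqP; rewrite /= eqEsubset Fc; apply/subsetP => A Ac.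
  suff -> : A = P by [].
  (* Critical generators of [x] form an antichain, and [P] contains them all. *)
  have Pc := subsetP Fc _ PF; apply: (critgen_sub_eq Ac Pc).
  rewrite /P CS; apply: (critgen_sub_critanc rS Ccs (setU11 _ _)).
  by rewrite -CS.
have -> : isnode (in_fam z) = false.
  rewrite cge_fields; move/eqP: F0; rewrite -cards_eq0 cardE -(perm_size famF).
  by case: (cge_fam I).
have -> : isnode (in_tab z) = (P != set0).
  rewrite cge_fields -cards_eq0 cardE -(perm_size keys) size_map.
  by case: (cge_anc I).
rewrite /P CS -(critgen_eq0 rS Ccs) -CS; case: ifP => [c0|/negbFE/eqP c0].
  have -> : tset (in_univ z) (fun=> true) = enc_set [set: 'I_n].
    by rewrite cge_univ; apply: tset_enc => i; rewrite inE.
  rewrite extract_enc; eexists; last by []; rewrite /= F0 setD0.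
  by rewrite CS in c0 *; apply: (ext_greedy_critgen rS Ccs); apply: (critgen_nonext rS Ccs).
by exists None => //=; rewrite c0.
Qed.

Hypothesis F_neq0 : F != set0.
Hypothesis PF : P \notin F.

(** An instance must list its rules without repetition. The three groups are disjoint: [P] is not in
    [F], and table rules conclude points of [P], which differ from [x]. *)
Lemma red_rules_uniq : uniq red_rules.
Proof.
case: CI => _ _ [keys tab] famF _.
have memF A : (A \in cge_fam I) = (A \in F) by rewrite (perm_mem famF) mem_enum.
have memP y : (y \in [seq r.1 | r <- cge_anc I]) = (y \in P).
  by rewrite (perm_mem keys) mem_enum.
have ukeys : uniq [seq r.1 | r <- cge_anc I] by rewrite (perm_uniq keys) enum_uniq.
have no_x A : (A, [set x]) \notin [seq (A, [set r.1]) | r <- cge_anc I, A <- r.2].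
  apply/negP => /allpairsPdep[r [B [rt _ [_ /set1_inj xr]]]].
  have : x \in P by rewrite -memP xr map_f.
  by rewrite !inE eqxx.
rewrite /red_rules /= mem_cat negb_or no_x andbT; apply/andP; split.
  by apply/mapP => -[A]; rewrite memF => AF [e]; case/negP: PF; rewrite e.
rewrite cat_uniq map_inj_uniq; last by move=> A B [].
rewrite (perm_uniq famF) enum_uniq /=; apply/andP; split.
  apply/hasPn => q qt; apply/mapP => -[A _ e].
  by have := no_x A; rewrite -e qt.
apply: allpairs_uniq_dep; first exact: map_uniq ukeys.
  by move=> r rt; rewrite (perm_uniq (tab _ rt)) enum_uniq.
move=> _ _ /allpairsPdep[r [A [rt _ ->]]] /allpairsPdep[r' [A' [rt' _ ->]]] /=.
case=> -> /set1_inj rr'.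
by rewrite (uniq_map_inj ukeys rt rt' rr').
Qed.

Lemma red_input_instance (S : implications 'I_n) r :
  ranks S r -> C = closed_sets S -> acs_instance red_input red_set.
Proof.
move=> rS CS; case: (CI) => _ Irr [keys tab] famF Fc.
have Ccs := cge_system; rewrite CS in Ccs.
have memP y : (y \in [seq r.1 | r <- cge_anc I]) = (y \in P).
  by rewrite (perm_mem keys) mem_enum.
have S'P := red_setP; rewrite /P CS in S'P; rewrite CS in Fc.
have ancE := reduction_anc rS Ccs Fc S'P.
split.
- exact (reduction_ib rS Ccs Fc S'P).
- exact (reduction_acyclic rS Ccs Fc S'P).
- exact (reduction_system rS Ccs Fc F_neq0 S'P).
- apply: uniq_perm; [exact: red_rules_uniq|exact: enum_uniq|].
  by move=> q; rewrite mem_enum [RHS]inE.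
split; first by rewrite ancE -map_comp -CS.
move=> _ /mapP[q qt ->] /=.
have qP : q.1 \in critanc (closed_sets S) x by rewrite -CS -/P -memP map_f.
rewrite (reduction_irr rS Ccs Fc S'P qP) -CS.
apply: uniq_perm; [|exact: enum_uniq|].
  by rewrite filter_uniq // (perm_uniq Irr) enum_uniq.
move=> N; rewrite mem_filter (perm_mem Irr) !mem_enum andb_idr //.
exact: subsetP (irr_sub_sys C _) N.
Qed.

Lemma postproc_reduction (S : implications 'I_n) r (l : seq {set 'I_n}) :
  ranks S r -> C = closed_sets S ->
  uniq l -> {subset l <= irr (closed_sets red_set) x} ->
  {subset irr (closed_sets red_set) x <= l} \/ size (cge_irr I) < size l ->
  exists2 a, cge_answer C F x a &
    postproc (Node z (esets l)) = enc_option (@enc_set n) a.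
Proof.
move=> rS CS ul lirr lfull; case: (CI) => _ Irr _ famF Fc.
have Ccs := cge_system; rewrite CS in Ccs.
have S'P := red_setP; rewrite /P CS in S'P; rewrite CS in Fc.
have Fnode : isnode (in_fam z).
  rewrite cge_fields; move: F_neq0; rewrite -cards_eq0 cardE -(perm_size famF).
  by case: (cge_fam I).
rewrite /postproc [tleft _]/= [tright _]/= Fnode new_sets_enc.
case new: [seq M <- l | M \notin irr C x] => [|M s] /=.
  exists None => //=; rewrite CS; apply: (reduction_complete rS Ccs Fc F_neq0 S'P).
  have lC M : M \in l -> M \in irr C x.
    move=> Ml; apply/negPn/negP => MN.
    have : M \in [seq M <- l | M \notin irr C x] by rewrite mem_filter MN.
    by rewrite new.
  case: lfull => [full|]; first by rewrite -CS; apply/subsetP => M /full; apply: lC.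
  rewrite ltnNge uniq_leq_size // => M /lC Mirr.
  by rewrite (perm_mem Irr) mem_enum (subsetP (irr_sub_sys C x)).
have /andP[MN Ml] : (M \notin irr C x) && (M \in l).
  by rewrite -(mem_filter (fun M => M \notin irr C x)) new mem_head.
have ne : nonext C x (x |: M).
  by rewrite CS; apply: (reduction_nonext rS Ccs Fc F_neq0 S'P); rewrite -?CS ?lirr.
have -> : tset (in_univ z) (fun i : tree => tmem i (enc_set M) || teqn i (in_x z)) = enc_set (x |: M).
  by rewrite cge_univ cge_fields; apply: tset_enc => i; rewrite tmem_enc teqn_enc !inE orbC.
rewrite extract_enc; eexists; last by []; rewrite /= inE.
have sub : ext C (greedy C x (x |: M)) \subset M.
  apply: subset_trans (_ : (x |: M) :\ x \subset M).
    by rewrite CS in ne *; apply: ext_greedy_sub.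
  by rewrite subDset subxx.
rewrite (reduction_new S'P (lirr _ Ml) sub) /=.
by rewrite CS in ne *; apply: (ext_greedy_critgen rS Ccs).
Qed.

End Instance.
End Encodings.

(** * The polynomial-time algorithm *)

Lemma poly_nat_bound (p : {poly nat}) : pb (fun n => (p.[n])%R).
Proof.
elim/poly_ind: p => [|p c IH].
  by apply: pb_le (pb_const 0) => n; rewrite horner0.
apply: (pb_le (b2 := fun n => (p.[n])%R * n + c)).
  by move=> n; rewrite hornerMXaddC.
exact: pb_add (pb_mul IH pb_id) (pb_const c).
Qed.

Lemma pb_poly b : pb b -> exists p : {poly nat}, forall n, b n <= (p.[n])%R.
Proof.
move=> [k hk]; exists (('X + 2%:P) ^+ k)%R => n; apply: leq_trans (hk n) _.
rewrite horner_exp hornerD hornerX hornerC.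
by elim: k {hk} => //= k IH; rewrite expnS GRing.exprS leq_mul.
Qed.

Lemma step_out k : exists2 s, out (step k) = out k ++ s & size s <= 1.
Proof.
case: k => -[|[i e|e|c1 c2|e c1 c2|e c] cs] s o /=;
  try by exists [::]; rewrite ?cats0.
  by exists [:: eval s e]; rewrite ?cats1.
by case: (eval s e); exists [::]; rewrite ?cats0.
Qed.

Lemma iter_step_out t k :
  exists2 s, out (iter t step k) = out k ++ s & size s <= t.
Proof.
elim: t => [|t [s e le]] /=; first by exists [::]; rewrite ?cats0.
have [s' e' le'] := step_out (iter t step k).
by exists (s ++ s'); rewrite ?e' ?e ?catA // size_cat; lia.
Qed.

Lemma iter_step_halted t k : todo k = [::] -> iter t step k = k.
Proof. by case: k => cs s o /= ->; elim: t => //= t ->. Qed.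

(** Outputs are never withdrawn, so those of a run cut by the clock begin the complete list. *)
Lemma run_prefix P d t o m : halts_with P d t o ->
  exists s, o = out (run P d m) ++ s.
Proof.
case=> halt <-; have [mt|tm] := leqP m t.
  have [s e _] := iter_step_out (t - m) (run P d m).
  by exists s; rewrite -e /run -iterD subnK.
exists [::]; rewrite cats0 -[in RHS](subnK (ltnW tm)) {2}/run iterD -/(run P d t).
by rewrite (iter_step_halted _ halt).
Qed.

Lemma size_out_run P d m : size (out (run P d m)) <= m.
Proof. by have [s -> ?] := iter_step_out m (init P d). Qed.

Lemma size_out_mono P d m1 m2 : m1 <= m2 ->
  size (out (run P d m1)) <= size (out (run P d m2)).
Proof.
move=> le; have [s e _] := iter_step_out (m2 - m1) (run P d m1).
by rewrite -(subnK le) /run iterD -/(run P d m1) e size_cat leq_addr.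
Qed.

(** If only [j <= N] outputs are out and more remain, the one of index [j] was due by time
    [p.[tsize d + j.+1]], which is at most [m]. *)
Lemma incremental_outputs n P (p : {poly nat}) d (l : seq {set 'I_n}) N m :
  incremental_time P p d [seq enc_set M | M <- l] ->
  (forall j, j <= N -> (p.[(tsize d + j.+1)%N])%R <= m) ->
  exists2 j, out (run P d m) = [seq enc_set M | M <- take j l] &
    size l <= j \/ N < size (take j l).
Proof.
move=> [[t halt] inc] le_m; have [s e] := run_prefix m halt.
exists (size (out (run P d m))).
  by rewrite map_take e take_size_cat.
set j := size (out _); have [lj|jl] := leqP (size l) j; [by left|right].
rewrite size_takel; last exact: ltnW.
rewrite ltnNge; apply/negP => jN.
have := inc j; rewrite size_map jl => /(_ isT).
by have := size_out_mono P d (le_m _ jN); rewrite -/j; lia.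
Qed.

Lemma tsize_node l r : tsize (Node l r) = (tsize l + tsize r).+1.
Proof. by []. Qed.

Lemma tsize_enc_set n (A : {set 'I_n}) : tsize (enc_set A) <= 4 * n + 1.
Proof.
rewrite /enc_set enc_seqE -map_comp -[n in 4 * n]size_enum_ord.
by elim: (enum 'I_n) => //= i s; rewrite -/(tlist _); case: (i \in A) => /=; lia.
Qed.

Lemma tsize_enc_sets n (l : seq {set 'I_n}) :
  tsize (enc_seq (@enc_set n) l) <= size l * (4 * n + 2) + 1.
Proof.
elim: l => //= A l IH; have := tsize_enc_set A; rewrite mulSn; lia.
Qed.

Lemma run_seq c1 c2 cs s o t1 s' t2 k :
  iter t1 step (Config [:: c1, c2 & cs] s o) = Config (c2 :: cs) s' o ->
  iter t2 step (Config (c2 :: cs) s' o) = k ->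
  iter (t1 + t2).+1 step (Config (Seq c1 c2 :: cs) s o) = k.
Proof. by move=> e1 e2; rewrite iterSr addnC iterD /= e1. Qed.

(** * Composition of preprocessing, clocked run and postprocessing *)

Section Algorithm.
Variables (P cpre cpost : cmd) (N1 N2 k1 k2 : nat).
Hypothesis N1_gt0 : 0 < N1.
Variable pre : tree -> tree.
Hypothesis hpre : computes cpre N1 pre (fun n => (n + 2) ^ k1).
Hypothesis hpost : computes cpost N2 postproc (fun n => (n + 2) ^ k2).

Let W := maxn N1 N2.

(** The clocked run has [V = W.+1]: clock in [W.+1], outputs in [W.+2], guard in [W.+3], variable 0
    of [P] in [W.+4]. The input is kept in [W], to be paired with the outputs for postprocessing. *)
Definition algorithm :=
  Seq cpre (Seq (Assign W (ELeft (EVar 0)))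
  (Seq (Assign W.+1 (ERight (ERight (EVar 0))))
  (Seq (Assign W.+4 (ELeft (ERight (EVar 0))))
  (Seq (clocked W.+1 P)
  (Seq (Assign 0 (ENode (EVar W) (EVar W.+2)))
  (Seq cpost (Emit (EVar 0)))))))).

Lemma algorithm_run x z d m outs :
  pre x = Node z d -> tright d = enc_nat m ->
  tlist (rev (out (run P (tleft d) m))) = outs ->
  exists2 t, t <= (tsize x + 2) ^ k1 + 12 * m + (tsize (Node z outs) + 2) ^ k2 + 20 &
    halts_with algorithm x t [:: postproc (Node z outs)].
Proof.
move=> prex dm outE; pose s := upd (fun=> Leaf) 0 x.
have [t1 [s1 [e1 le1 v1 f1]]] := hpre s.
have s0 : s 0 = x by [].
rewrite s0 prex in v1; rewrite s0 in le1.
(* Preprocessing leaves the registers from [W] on at [Leaf], so the output list and the other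
   simulated variables start as in [init]. *)
have s1L j : W <= j -> s1 j = Leaf.
  by move=> jW; rewrite f1 /s; [vars|rewrite /W in jW; lia].
pose s2 := upd s1 W z.
pose s3 := upd s2 W.+1 (enc_nat m).
pose s4 := upd s3 W.+4 (tleft d).
have W0 : 0 < W by rewrite /W; lia.
have e2 : exec (Assign W (ELeft (EVar 0))) s1 1 s2.
  by have := exec_assign W (ELeft (EVar 0)) s1; rewrite /= v1.
have s20 : s2 0 = Node z d by rewrite /s2; vars.
have e3 : exec (Assign W.+1 (ERight (ERight (EVar 0)))) s2 1 s3.
  have := exec_assign W.+1 (ERight (ERight (EVar 0))) s2; rewrite /= s20.
  by rewrite -[if d is Node _ r then r else Leaf]/(tright d) dm.
have s30 : s3 0 = Node z d by rewrite /s3; vars.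
have e4 : exec (Assign W.+4 (ELeft (ERight (EVar 0)))) s3 1 s4.
  by have := exec_assign W.+4 (ELeft (ERight (EVar 0))) s3; rewrite /= s30.
have sim : simulates W.+1 s4 m (upd (fun=> Leaf) 0 (tleft d)) [::].
  split=> [||i]; rewrite /s4 /s3 /s2; first by vars.
    by vars; apply: s1L; lia.
  case: i => [|i]; first by rewrite addn0; vars.
  by vars; apply: s1L; lia.
have [t5 [s5 [le5 e5 o5 f5]]] := clocked_run [::]
  (StackS P (Stack0 W.+1 [:: Seq (Assign 0 (ENode (EVar W) (EVar W.+2)))
     (Seq cpost (Emit (EVar 0)))])) sim.
rewrite -/(run P (tleft d) m) outE in o5.
have s5W : s5 W = z by rewrite f5 // /s4 /s3 /s2; vars.
pose s6 := upd s5 0 (Node z outs).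
have e6 : exec (Assign 0 (ENode (EVar W) (EVar W.+2))) s5 1 s6.
  by have := exec_assign 0 (ENode (EVar W) (EVar W.+2)) s5; rewrite /= s5W o5.
have [t7 [s7 [e7 le7 v7 _]]] := hpost s6.
have s60 : s6 0 = Node z outs by rewrite /s6; vars.
rewrite s60 in le7 v7.
exists ((t1 + (1 + (1 + (1 + (t5 + (1 + (t7 + 1).+1).+1).+1).+1).+1).+1).+1).
  by move: le1 le5 le7; rewrite /=; lia.
rewrite /halts_with /run /init -/s; set k := iter _ _ _.
suff -> : k = Config [::] s7 [:: postproc (Node z outs)] by [].
apply: run_seq (e1 _ _) _; apply: run_seq (e2 _ _) _.
apply: run_seq (e3 _ _) _; apply: run_seq (e4 _ _) _.
apply: run_seq e5 _; apply: run_seq (e6 _ _) _.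
by apply: run_seq (e7 _ _) _; rewrite /= v7.
Qed.
End Algorithm.

Theorem theorem38 :
  (exists P : cmd, solves_ACS_A_Enum_incpoly P) ->
  (exists Q : cmd, solves_CGE_A_Dec_poly Q).
Proof.
case=> P [p solP]; have [K pK] := poly_nat_bound p.
have [cpre [N1 [k1 [N1_gt0 hpre zpre]]]] := FP_preproc K.
have [cpost [N2 [k2 [_ hpost _]]]] := FP_postproc.
exists (algorithm P cpre cpost N1 N2).
(* Preprocessing, clocked run, postprocessing. The clock is part of the output of preprocessing,
   hence at most [(n + 2) ^ k1]; it also bounds the number of listed sets, each taking at most
   [4 * n + 2]. *)
pose b n := (n + 2) ^ k1 + 12 * (n + 2) ^ k1 +
  (n + ((n + 2) ^ k1 * (4 * n + 2) + 1) + 1 + 2) ^ k2 + 20.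
have [|q hq] := @pb_poly b; first by rewrite /b; pb.
exists q => n I C F CI; pose z := enc_cge I.
have [[Ccs [S [_ acS CS]]] _ _ _ _] := CI.
have [r rS] := acyclic_ranks acS.
(* Outputs are stored last first, hence [rev l]. *)
have finish d m (l : seq {set 'I_n}) : preproc K z = Node z d -> tright d = enc_nat m ->
    out (run P (tleft d) m) = [seq enc_set M | M <- l] ->
    (exists2 a, cge_answer C F (cge_x I) a &
       postproc (Node z (enc_seq (@enc_set n) (rev l))) = enc_option (@enc_set n) a) ->
    exists2 a, cge_answer C F (cge_x I) a &
      poly_time (algorithm P cpre cpost N1 N2) q z (enc_option (@enc_set n) a).
  move=> prez dm outl [a Ha posta]; exists a => //.
  have outE : tlist (rev (out (run P (tleft d) m))) = enc_seq (@enc_set n) (rev l).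
    by rewrite outl -map_rev enc_seqE.
  have [t le] := algorithm_run N1_gt0 hpre hpost prez dm outE.
  rewrite posta => halt; exists t => //.
  apply: leq_trans le _; apply: leq_trans (hq _).
  have mk : m <= (tsize z + 2) ^ k1.
    have := zpre z; rewrite prez; have := tsize_right d; rewrite dm tsize_enc_nat /=; lia.
  have lm : size l <= m.
    by rewrite -(size_map (@enc_set n)) -outl size_out_run.
  have nz : n <= tsize z by rewrite /= tsize_enc_nat; lia.
  rewrite /b; apply: leq_add => //; apply: leq_add; first by lia.
  apply: pow_mono; rewrite tsize_node; have := tsize_enc_sets (rev l); rewrite size_rev.
  have : size l * (4 * n + 2) <= (tsize z + 2) ^ k1 * (4 * tsize z + 2).
    by apply: leq_mul; lia.
  by lia.
case triv: (trivial_case z).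
  apply: (finish Leaf 0 [::]) => //; first by rewrite /preproc triv.
  by apply: (postproc_trivial CI rS CS); rewrite -trivial_caseE.
have /norP[F0 PF] := negbT (etrans (esym (trivial_caseE CI)) triv).
have inst := red_input_instance CI F0 PF rS CS.
have [l lperm inc] := solP _ _ _ inst.
pose d' := enc_acs (red_input I C).
(* Counting the size of [z] too leaves time for [(size (cge_irr I)).+1] outputs, since that list is
   part of [z]. *)
pose m := (tsize (Node d' z) + 2) ^ K.
have [j jN|j outj jfull] := incremental_outputs (N := size (cge_irr I)) (m := m) inc.
  apply: leq_trans (pK _) _; apply: pow_mono => /=.
  have : size (cge_irr I) < tsize (enc_seq (@enc_set n) (cge_irr I)).
    by rewrite -(size_map (@enc_set n)) -tseq_sets size_tseq.
  by rewrite -/d'; lia.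
apply: (finish (Node d' (enc_nat m)) m (take j l)) => //.
  by rewrite /preproc triv (reduction_enc CI).
apply: (postproc_reduction CI F0 rS CS).
- by rewrite rev_uniq take_uniq // (perm_uniq lperm) enum_uniq.
- by move=> M; rewrite mem_rev => /mem_take; rewrite (perm_mem lperm) mem_enum.
case: jfull => [lj|]; [left=> M|by right; rewrite size_rev].
by rewrite mem_rev take_oversize // (perm_mem lperm) mem_enum.
Qed.
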